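(* Assume in addition that $\kappa>0$. Then there exists $\alpha_0\in(0,1)$ such that \[ \Lambda(\alpha)=c-K|\alpha|\quad\text{for all }\alpha\in[-\alpha_0,\alpha_0],\qquad\text{where } K=\frac{c-\Lambda(\alpha_0)}{\alpha_0}. \]
   Context: Let $c>0$, $q>0$, $\kappa>-1$. $F=(F(x))_{x\in\mathbb Z}$ and $B=(B(i))_{i\in\mathbb Z}$ are mutually independent families of i.i.d. random variables, $\mathbb P(B(i)=\pm1)=1/2$, and $F(x)$ has a density $\varrho$ that is even, continuous, strictly positive on $(-c,c)$, zero outside $(-c,c)$, with $\lim_{x\to c}\varrho(x)/|c-x|^{\kappa}=q$. Lazy walks $\gamma$ satisfy $|\gamma(i+1)-\gamma(i)|\le 1$; for a lazy walk $\gamma$ on $\{0,\dots,n\}$ the action is $A(B,F;\gamma)=\sum_{i=1}^n B(i)F(\gamma(i))$, and $\bar A(B,F;n,k)$ is the minimum of the action over lazy walks with $\gamma(0)=0$, $\gamma(n)=k$. $[x]$ denotes rounding towards $0$. The shape function is the deterministic continuous even concave function $\Lambda:[-1,1]\to[0,\infty)$ such that almost surely, for all $\alpha\in[-1,1]$, $\bar A(B,F;n,[\alpha n])/n\to-\Lambda(\alpha)$ as $n\to\infty$. *)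

(* Defs.v *)
From HB Require Import structures.
From mathcomp Require Import all_boot all_order all_algebra.
From mathcomp Require Import all_classical all_reals all_analysis.
Set Implicit Arguments. Unset Strict Implicit. Unset Printing Implicit Defensive.
Import Order.TTheory GRing.Theory Num.Theory.
Import numFieldNormedType.Exports.
Local Open Scope classical_set_scope.
Local Open Scope ring_scope.

Definition mutually_independent {d} {T : measurableType d} {R : realType}
  (P : probability T R) {I : eqType} (X : I -> T -> R) : Prop :=
  forall (s : seq I) (A : I -> set R), uniq s ->
    (forall i, i \in s -> measurable (A i)) ->
    P (\bigcap_(i in [set i | i \in s]) (X i @^-1` A i)) =
    (\prod_(i <- s) P (X i @^-1` A i))%E.

Definition FB_family {T : Type} {R : Type} (F B : int -> T -> R) :
  (int + int)%type -> T -> R :=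
  fun j => match j with inl x => F x | inr i => B i end.

Definition lazy_walk (n : nat) (k : int) (g : nat -> int) : Prop :=
  g 0%N = 0 /\ g n = k /\ (forall i, (i < n)%N -> `|g i.+1 - g i| <= 1).

Definition action {R : realType} (b f : int -> R) (n : nat) (g : nat -> int) : R :=
  \sum_(1 <= i < n.+1) b i%:Z * f (g i).

(* Minimal action over lazy walks with gamma(0)=0, gamma(n)=k
   (a minimum over a finite set of values, written as its infimum). *)
Definition min_action {R : realType} (b f : int -> R) (n : nat) (k : int) : R :=
  inf [set action b f n g | g in [set g | lazy_walk n k g]].

Definition round0 {R : realType} (x : R) : int :=
  if 0 <= x then Num.floor x else - Num.floor (- x).

(* Main.v *)
Require Import Defs.
From HB Require Import structures.
From mathcomp Require Import all_boot all_order all_algebra.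
From mathcomp Require Import all_classical all_reals all_analysis.
From mathcomp Require Import measurable_realfun.
From mathcomp Require Import ring lra zify.
Import Order.TTheory GRing.Theory Num.Theory.
Import numFieldNormedType.Exports.
Local Open Scope classical_set_scope.
Local Open Scope ring_scope.
Set Implicit Arguments. Unset Strict Implicit. Unset Printing Implicit Defensive.

(** Put h = c - Lambda, which is convex with h(0) = 0: it is the optimal rate of the loss
    sum_i (c + B(i) F(gamma(i))), whose terms are nonnegative.  It suffices to find a slope
    a1 and a0 = (32/31) a1 with h(a1)/a1 >= h(a0)/a0; convexity then makes h linear on [0, a0].

    When B(i) and B(i+1) differ, the two steps lose at least the gap
    2c - |F(x) - F(x+1)| of the bond used.  If a1 is small, a nearly optimal walk of slope a1
    must therefore spend most of its time on bonds of small gap.  Cut out the time spent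
    at the bonds of gap < 2^-j, between the first and last visit to each of them.  The signs B
    that are kept are again i.i.d.  Bounded differences, with a union bound over the few
    possible sets of kept times, show that the shorter walk cannot lose much less than
    expected.  So the time T_j n spent at gap level j satisfies T_j 2^-j <= const * sqrt(p_j)
    up to logarithms, where p_j ~ 4^(-j(kappa+1)) is the density of such bonds, and
    sum_j 2^j sqrt(p_j) converges because kappa > 0.  Hence, for every J, a positive
    fraction of the time is spent on bonds of gap < 2^-J; cutting it out produces a walk of slope
    >= a0 at no extra loss, up to an error that vanishes as J grows. *)

(** * Averages over bit strings *)

(** The obstacle: the times to cut are read off a nearly optimal walk, hence depend on the signs,
    whereas the kept signs are i.i.d. only for a set of times fixed in advance. The deviation bound
    must hold for all candidate sets at once, so the logarithm of their number has to stay below the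
    concentration exponent. This is why one interval is cut per site instead of every visit: two
    endpoints per site give, at level j, an entropy of order p_j n up to logarithms, against an
    exponent of order D^2 n for a deviation D n; hence D of order sqrt(p_j).

    The environment is frozen, expectation over the signs is the uniform average [avg] over bit
    strings, and the limit defining Lambda is used at finitely many slopes at a time, through
    convergence in probability. A first-moment argument supplies one suitable environment.

    The order of choices matters: the coarsest level j0 fixes a1 and a0, and J is sent to infinity
    afterwards. The ratio 32/31 comes from rounding: the final cut keeps at most 15/16 of the time,
    and 1/32 is given away when lengths are rounded up to a grid. *)

Fixpoint avg {R : realType} (n : nat) (g : seq bool -> R) : R :=
  if n is n'.+1
  then (avg n' (fun b => g (true :: b)) + avg n' (fun b => g (false :: b))) / 2
  else g [::].

Section Averages.
Context {R : realType}.
Implicit Types (g : seq bool -> R) (n : nat).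

Lemma le_avg n g g' :
  (forall b, size b = n -> g b <= g' b) -> avg n g <= avg n g'.
Proof.
elim: n g g' => [|n IH] g g' gg' /=; first exact: gg'.
rewrite ler_pM2r ?invr_gt0 //; apply: lerD; apply: IH => b sb;
  by apply: gg'; rewrite /= sb.
Qed.

Lemma eq_avg n g g' :
  (forall b, size b = n -> g b = g' b) -> avg n g = avg n g'.
Proof.
by move=> e; apply/eqP; rewrite eq_le !le_avg // => b sb; rewrite e.
Qed.

Lemma avg_cst n (a : R) : avg n (fun=> a) = a.
Proof. by elim: n => //= n ->; field. Qed.

Lemma avgD n g g' : avg n (fun b => g b + g' b) = avg n g + avg n g'.
Proof.
elim: n g g' => [|n IH] g g' /=; first by [].
  by rewrite !IH; field.
Qed.

Lemma avgZ n (a : R) g : avg n (fun b => a * g b) = a * avg n g.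
Proof. elim: n g => //= n IH g; rewrite !IH; by field. Qed.

Lemma avgN n g : avg n (fun b => - g b) = - avg n g.
Proof. elim: n g => //= n IH g; rewrite !IH; by field. Qed.

Lemma avgB n g g' : avg n (fun b => g b - g' b) = avg n g - avg n g'.
Proof. by rewrite avgD avgN. Qed.

Lemma avg_sum (I : Type) (s : seq I) n (g : I -> seq bool -> R) :
  avg n (fun b => \sum_(i <- s) g i b) = \sum_(i <- s) avg n (g i).
Proof.
elim: s => [|i s IH].
  by rewrite big_nil -[RHS](avg_cst n); apply: eq_avg => b _; rewrite big_nil.
rewrite big_cons -IH -avgD; apply: eq_avg => b _; by rewrite big_cons.
Qed.

Lemma avg_cat m n g :
  avg (m + n) g = avg m (fun b => avg n (fun b' => g (b ++ b'))).
Proof. by elim: m g => //= m IH g; rewrite !IH. Qed.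

(** Deleted bits do not enter the integrand, so averaging over them changes nothing: the signs kept
    by a fixed mask are again uniform. *)
Lemma avg_mask (m : bitseq) g :
  avg (size m) (fun b => g (mask m b)) = avg (count id m) g.
Proof.
elim: m g => //= -[] m IH g /=.
  by rewrite (IH (fun b => g (true :: b))) (IH (fun b => g (false :: b))).
by rewrite !IH add0n; field.
Qed.

Lemma avg_lt_ex n g a : avg n g < a -> exists2 b, size b = n & g b < a.
Proof.
move=> h; apply: contrapT => H; move: h; apply/negP; rewrite -leNgt.
rewrite -(avg_cst n a); apply: le_avg => b sb; rewrite leNgt; apply/negP => gb.
by apply: H; exists b.
Qed.

Lemma avg_ge0 n g : (forall b, size b = n -> 0 <= g b) -> 0 <= avg n g.
Proof. by move=> g0; rewrite -(avg_cst n 0); exact: le_avg. Qed.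

(** An explicit enumeration turns averages into finite sums, as needed for union bounds over masks
    and for sums of probabilities over sign strings. *)
Fixpoint bits (n : nat) : seq (seq bool) :=
  if n is n'.+1 then map (cons true) (bits n') ++ map (cons false) (bits n')
  else [:: [::]].

Lemma mem_bits n b : (b \in bits n) = (size b == n).
Proof.
elim: n b => [|n IH] [|a b] //=; rewrite mem_cat.
  by apply/negbTE/negP => /orP[] /mapP[].
rewrite eqSS -IH; case: a; apply/orP/idP.
- by case=> /mapP[x] // xb [->].
- by move=> bb; left; apply: map_f.
- by case=> /mapP[x] // xb [->].
- by move=> bb; right; apply: map_f.
Qed.

Lemma avgE n g : avg n g = (\sum_(b <- bits n) g b) / 2 ^+ n.
Proof.
elim: n g => [|n IH] g /=; first by rewrite big_seq1 divr1.
rewrite !IH big_cat !big_map exprS /=; field.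
exact: lt0r_neq0 (exprn_gt0 _ _).
Qed.

(** The sharp exponent is x^2 / 2; the weaker 2 x^2 follows from [expR_ge1Dx] alone. For 0 <= x <=
    1/2 the mean of 1 / (1 - x) and 1 / (1 + x) is 1 / (1 - x^2) <= 1 + 2 x^2; for x > 1/2 already
    exp x <= exp (2 x^2). *)
Lemma cosh_le (x : R) : (expR x + expR (- x)) / 2 <= expR (2 * x ^+ 2).
Proof.
wlog x0 : x / 0 <= x.
  move=> H; have [|/ltW x0] := leP 0 x; first exact: H.
  by have := H (- x); rewrite oppr_ge0 opprK sqrrN addrC; apply.
have [xs|xl] := leP x (1/2).
  have e1 : expR x <= (1 - x)^-1.
    by rewrite -[x in expR x]opprK expRN lef_pV2 ?posrE ?expR_gt0 ?expR_ge1Dx //; lra.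
  have e2 : expR (- x) <= (1 + x)^-1.
    by rewrite expRN lef_pV2 ?posrE ?expR_gt0 ?expR_ge1Dx //; lra.
    apply: (@le_trans _ _ (1 + 2 * x ^+ 2)); last exact: expR_ge1Dx.
  have -> : 1 + 2 * x ^+ 2 =
    ((1 - x)^-1 + (1 + x)^-1) / 2 + x ^+ 2 * (1 - 2 * x ^+ 2) / ((1 - x) * (1 + x)).
    field; apply/andP; split; apply/eqP; lra.
  rewrite -[leLHS]addr0; apply: lerD; first by rewrite ler_pM2r ?invr_gt0 // lerD.
  apply: divr_ge0; last by apply: mulr_ge0; lra.
  apply: mulr_ge0; first exact: sqr_ge0.
  have : x ^+ 2 <= (1/2) ^+ 2 by rewrite lerXn2r ?nnegrE //; lra.
  rewrite !expr2; lra.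
apply: (@le_trans _ _ (expR x)).
  have : expR (- x) <= expR x by rewrite ler_expR; lra.
  lra.
by rewrite ler_expR expr2; nra.
Qed.

(* Bounded-differences (McDiarmid) inequality on the cube, in exponential form. *)
Lemma avg_expR_dev n g (c l : R) :
  (forall b1 b2, (size b1 + size b2).+1 = n ->
     `|g (b1 ++ true :: b2) - g (b1 ++ false :: b2)| <= 2 * c) ->
  avg n (fun b => expR (l * (avg n g - g b))) <= expR (2 * l ^+ 2 * c ^+ 2 * n%:R).
Proof.
elim: n g => [|n IH] g gc /=.
  by rewrite subrr !mulr0 expR0.
set gt := fun b => g (true :: b); set gf := fun b => g (false :: b).
set ut := avg n gt; set uf := avg n gf.
have IHt : avg n (fun b => expR (l * (ut - gt b))) <= expR (2 * l ^+ 2 * c ^+ 2 * n%:R).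
  by apply: IH => b1 b2 sb; apply: (gc (true :: b1)); rewrite /= addSn sb.
have IHf : avg n (fun b => expR (l * (uf - gf b))) <= expR (2 * l ^+ 2 * c ^+ 2 * n%:R).
  by apply: IH => b1 b2 sb; apply: (gc (false :: b1)); rewrite /= addSn sb.
have dut : `|ut - uf| <= 2 * c.
  have d b : size b = n -> `|gt b - gf b| <= 2 * c.
    by move=> sb; apply: (gc [::]); rewrite /= sb.
  rewrite -avgB ler_norml -[X in X <= _](avg_cst n) -[X in _ && (_ <= X)](avg_cst n).
  by apply/andP; split; apply: le_avg => b /d; rewrite ler_norml => /andP[].
have -> : avg n (fun b => expR (l * ((ut + uf) / 2 - g (true :: b)))) =
    expR (- (l * (ut - uf) / 2)) * avg n (fun b => expR (l * (ut - gt b))).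
  by rewrite -avgZ; apply: eq_avg => b _; rewrite -expRD; congr expR; rewrite /gt; field.
have -> : avg n (fun b => expR (l * ((ut + uf) / 2 - g (false :: b)))) =
    expR (l * (ut - uf) / 2) * avg n (fun b => expR (l * (uf - gf b))).
  by rewrite -avgZ; apply: eq_avg => b _; rewrite -expRD; congr expR; rewrite /gf; field.
(* The first bit shifts the conditional mean by half of [ut - uf] in either direction. It
   contributes the factor cosh z, and z^2 <= l^2 c^2. *)
set z := l * (ut - uf) / 2.
apply: (@le_trans _ _ ((expR z + expR (- z)) / 2 * expR (2 * l ^+ 2 * c ^+ 2 * n%:R))).
  rewrite mulrAC ler_pM2r ?invr_gt0 // mulrDl addrC.
  by apply: lerD; apply: ler_wpM2l => //; exact: expR_ge0.
apply: (le_trans (ler_wpM2r (expR_ge0 _) (cosh_le z))).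
rewrite -expRD ler_expR -natr1.
have zz : z ^+ 2 <= l ^+ 2 * c ^+ 2.
  rewrite /z !exprMn exprVn.
  have : (ut - uf) ^+ 2 <= (2 * c) ^+ 2.
    rewrite -(real_normK (num_real _)) lerXn2r ?nnegrE //.
    exact: le_trans dut.
  have := sqr_ge0 l; rewrite exprMn; move: (l ^+ 2) (c ^+ 2) ((ut - uf) ^+ 2).
  move=> a b d a0 db; have : a * d <= a * (2 ^+ 2 * b) by apply: ler_wpM2l.
  lra.
lra.
Qed.

(** Exponential Markov inequality; [l] stays free and is tuned at each use. *)
Lemma avg_dev n g (c l t : R) : 0 <= l ->
  (forall b1 b2, (size b1 + size b2).+1 = n ->
     `|g (b1 ++ true :: b2) - g (b1 ++ false :: b2)| <= 2 * c) ->
  avg n (fun b => (g b < avg n g - t)%R%:R : R) <=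
  expR (2 * l ^+ 2 * c ^+ 2 * n%:R - l * t).
Proof.
move=> l0 gc.
apply: (@le_trans _ _ (expR (- (l * t)) * avg n (fun b => expR (l * (avg n g - g b))))).
  rewrite -avgZ; apply: le_avg => b _; rewrite -expRD.
  case: ltP => [gb|_] /=; last exact: expR_ge0.
  rewrite -{1}expR0 ler_expR -mulrN -mulrDr; apply: mulr_ge0 => //; lra.
rewrite addrC expRD; apply: ler_wpM2l; first exact: expR_ge0.
exact: avg_expR_dev.
Qed.

End Averages.

(** * Loop erasure *)

Definition near1 (x y : int) : bool := `|y - x| <= 1.

(** The switches of a mask measure two things: each of them spoils at most one pair in the
    accounting of losses, and masks with few switches are few. *)
Fixpoint sw (a : bool) (m : bitseq) : nat :=
  if m is b :: m' then ((a != b) + sw b m')%N else 0%N.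

Lemma sw_cat a m1 m2 : sw a (m1 ++ m2) = (sw a m1 + sw (last a m1) m2)%N.
Proof. by elim: m1 a => //= b m1 IH a; rewrite IH addnA. Qed.

Lemma sw_le a b m : (sw a m <= (sw b m).+1)%N.
Proof. by case: m => //= d m; case: a b d => -[] [] /=; lia. Qed.

Lemma sw_nseq a b k : (sw a (nseq k b) <= 1)%N.
Proof.
case: k => //= k; have -> : sw b (nseq k b) = 0%N by elim: k => //= k ->; rewrite eqxx.
by rewrite addn0 leq_b1.
Qed.

Lemma sw_erase a m1 m2 m3 :
  (sw a (m1 ++ nseq (size m2) false ++ m3) <= sw a (m1 ++ m2 ++ m3) + 2)%N.
Proof.
rewrite !sw_cat.
have h1 := sw_nseq (last a m1) false (size m2).
case: m2 h1 => [|d m2] h1; first by rewrite leq_addr.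
have h2 := sw_le (last (last a m1) (nseq (size (d :: m2)) false))
   (last (last a m1) (d :: m2)) m3.
lia.
Qed.

Lemma mask_split (T : Type) (m : bitseq) (s p u : seq T) : size m = size s ->
  mask m s = p ++ u ->
  exists m1 m2 s1 s2, [/\ m = m1 ++ m2, s = s1 ++ s2, size m1 = size s1,
    mask m1 s1 = p & mask m2 s2 = u].
Proof.
elim: m s p => [|a m IH] [|x s] p //=.
  by case: p u => [|? ?] [|? ?] // _ _; exists [::], [::], [::], [::].
move=> [sm]; case: a => /=.
  case: p => [|y p] /=.
    by move=> <-; exists [::], (true :: m), [::], (x :: s).
  move=> [<-] /(IH _ _ sm)[m1 [m2 [s1 [s2 [-> -> sz <- <-]]]]].
  by exists (true :: m1), m2, (x :: s1), s2; split => //=; rewrite sz.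
move=> /(IH _ _ sm)[m1 [m2 [s1 [s2 [-> -> sz <- <-]]]]].
by exists (false :: m1), m2, (x :: s1), s2; split => //=; rewrite sz.
Qed.

(** The block [r] comes from a contiguous stretch of the mask. Setting that stretch to [false]
    removes exactly [r], and new switches can appear only at its two ends. *)
Lemma mask_erase (T : Type) (m : bitseq) (s p r t : seq T) : size m = size s ->
  mask m s = p ++ r ++ t ->
  exists m', [/\ size m' = size s, mask m' s = p ++ t &
    (sw true m' <= sw true m + 2)%N].
Proof.
move=> sm /(mask_split sm)[m1 [m2 [s1 [s2 [Em Es sz1 e1 e2]]]]].
have sz2 : size m2 = size s2.
  by move: sm; rewrite Em Es !size_cat sz1 => /addnI.
have [m3 [m4 [s3 [s4 [Em2 Es2 sz3 e3 e4]]]]] := mask_split sz2 e2.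
exists (m1 ++ nseq (size m3) false ++ m4); split.
- rewrite -sm Em Em2 !size_cat size_nseq //.
- rewrite Es Es2 !mask_cat ?size_nseq // e1 e4 mask_false //.
- by rewrite Em Em2 sw_erase.
Qed.

(* The mask erases, site by site, the loop between the first and the last visit. *)
Lemma loop_erasure (E : seq int) (x0 : int) (s : seq int) :
  path near1 x0 s ->
  exists m, [/\ size m = size s, (sw true m <= 2 * size E)%N,
    path near1 x0 (mask m s), last x0 (mask m s) = last x0 s &
    (count (mem E) (mask m s) <= size E)%N].
Proof.
move=> ps; elim: E => [|e E [m [sm swm pm lm cm]]].
  exists (nseq (size s) true); rewrite size_nseq mask_true //; split => //.
    by elim: (size s).
  by rewrite count_pred0.
have [ne|] := boolP (e \in mask m s); last first.
  move=> ne; exists m; split => //; first by move: swm => /=; lia.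
  rewrite (@eq_in_count _ _ (mem E)) /= ; first exact: leqW.
  by move=> x xm; rewrite /= inE; case: eqP => // xe; rewrite -xe xm in ne.
(* [p] is what precedes the first visit to [e], and [t] below is what follows the last one. In
   [p ++ e :: t] the step into [e] is that of the first visit and the step out of [e] that of the
   last, so the result is still a lazy path, with a single visit to [e]. *)
have [p [q [Epq pe]]] : exists p q, mask m s = p ++ e :: q /\ e \notin p.
  move: ne; elim: (mask m s) => // y u IH; rewrite inE.
  have [->|ney /= /IH[p [q [-> ep]]]] := eqVneq e y; first by exists [::], u.
  by exists (y :: p), q; split => //; rewrite inE negb_or ney.
have [r [t [Ert te]]] : exists r t, e :: q = r ++ e :: t /\ e \notin t.
  elim/last_ind: q {Epq} => [|q y [r [t [Er et]]]]; first by exists [::], [::].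
  have [ye|ney] := eqVneq y e.
    by exists (e :: q), [::]; rewrite ye cats1.
  exists r, (rcons t y); rewrite -!rcons_cons Er rcons_cat; split => //.
  by rewrite mem_rcons inE negb_or eq_sym ney.
have Em : mask m s = p ++ r ++ e :: t by rewrite Epq Ert.
have [m' [sm' Em' swm']] := mask_erase sm Em.
exists m'; rewrite Em'; split => //.
- by move: swm => /=; lia.
- move: pm; rewrite Epq !cat_path /= => /and3P[-> -> pq] /=.
  case: r Ert {Em} => [[<-] //|y r [_ Eq]].
  by move: pq; rewrite Eq cat_path /= => /and3P[].
- by rewrite -lm Em !last_cat.
- have cE : (count (mem E) (p ++ e :: t) <= count (mem E) (mask m s))%N.
    by rewrite Em !count_cat; lia.
  have -> : count (mem (e :: E)) (p ++ e :: t) =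
      (count (mem E) (p ++ e :: t) + (e \notin E))%N.
    have aux u : e \notin u -> count (mem (e :: E)) u = count (mem E) u.
      move=> eu; apply: eq_in_count => x xu /=; rewrite inE.
      by case: eqP => // xe; rewrite -xe xu in eu.
    rewrite !count_cat /= !aux // inE eqxx /=; case: (e \in E) => /=; lia.
  apply: (@leq_trans (count (mem E) (mask m s)).+1); last exact: cm.
  by case: (e \in E) => /=; rewrite ?addn0 ?addn1 // leqW.
Qed.

(** * Losses of lazy walks *)

(** The pairs of neighbours are disjoint: their losses add up to at most the total loss, and a given
    sign enters only one pair. *)
Fixpoint npairs (T : Type) (G : T -> T -> nat) (s : seq T) : nat :=
  match s with
  | u :: t => if t is v :: s' then (G u v + npairs G s')%N else 0%N
  | [::] => 0%N
  end.

Lemma seq_ind2 (T : Type) (Q : seq T -> Prop) :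
  Q [::] -> (forall u, Q [:: u]) -> (forall u v s, Q s -> Q (u :: v :: s)) ->
  forall s, Q s.
Proof.
move=> Q0 Q1 Q2 s; have [k] := ubnP (size s).
elim: k s => // k IH [|u [|v s]] //= sk; apply: Q2; apply: IH; lia.
Qed.

Lemma npairsD (T : Type) (G G' : T -> T -> nat) s :
  npairs (fun u v => G u v + G' u v)%N s = (npairs G s + npairs G' s)%N.
Proof. by elim/seq_ind2: s => //= u v s ->; rewrite addnACA. Qed.

Lemma npairs_sum (T I : Type) (r : seq I) (G : I -> T -> T -> nat) s :
  npairs (fun u v => \sum_(i <- r) G i u v)%N s = (\sum_(i <- r) npairs (G i) s)%N.
Proof.
elim/seq_ind2: s => [||u v s IH] /=; try by rewrite big1_eq.
by rewrite IH -big_split.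
Qed.

Lemma npairs_map (T T' : Type) (h : T -> T') (G : T' -> T' -> nat) s :
  npairs G (map h s) = npairs (fun u v => G (h u) (h v)) s.
Proof. by elim/seq_ind2: s => //= u v s ->. Qed.

Lemma le_npairs_path (T : eqType) (e : rel T) (G G' : T -> T -> nat) x0 s :
  path e x0 s ->
  (forall u v, u \in s -> v \in s -> e u v -> (G u v <= G' u v)%N) ->
  (npairs G s <= npairs G' s)%N.
Proof.
elim/seq_ind2: s x0 => //= u v s IH x0 /and3P[_ euv ps] H.
apply: leq_add; first by apply: H; rewrite ?inE ?eqxx ?orbT.
by apply: (IH v) => // a b sa sb; apply: H; rewrite !inE ?sa ?sb !orbT.
Qed.

(** * What a cut saves, pair by pair *)

Section Accounting.
Context {R : realType}.

(** Each counted pair is paid for in one of three ways. If both terms are deleted, at least [d] is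
    saved; if exactly one is deleted, the mask switches inside the pair; if both are kept, one of
    them is a surviving visit to [E]. *)
Lemma npairs_mask (T : Type) (l : T -> R) (E : pred T) (G : T -> T -> nat) (d : R)
  (s : seq T) (m : bitseq) (a : bool) :
  0 <= d -> (forall u, 0 <= l u) ->
  (forall u v, (0 < G u v)%N -> [/\ G u v = 1%N, d <= l u + l v & E u || E v]) ->
  size m = size s ->
  \sum_(u <- mask m s) l u + d * (npairs G s)%:R <=
  \sum_(u <- s) l u + d * (sw a m + count E (mask m s))%:R.
Proof.
move=> d0 l0 HG; elim/seq_ind2: s m a => [|u|u v s IH] m a.
- by move: m => [|? ?] // _; rewrite !big_nil /= !mulr0.
- move: m => [|x [|? ?]] // _; rewrite /= mulr0 addr0.
  have hd k : 0 <= d * k%:R by rewrite mulr_ge0.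
  case: x => /=; rewrite ?big_seq1 ?big_nil.
    by rewrite lerDl.
  by rewrite addr_ge0.
move: m => [|x [|y m]] //= [sm].
have {IH} := IH m y sm.
have := HG u v; case: (G u v) => [|k] /=; last first.
  case=> // [->] /=.
  case: x; case: y => /= duv Euv IH; rewrite ?big_cons !natrD /=.
  - have : (1 : R) <= (E u)%:R + (E v)%:R.
      by case: (E u) Euv => /= [_|->]; rewrite ?lerDl ?add0r.
    have w0 : 0 <= d * ((a != true)%:R : R) by rewrite mulr_ge0.
    move=> h; have : d * 1 <= d * ((E u)%:R + (E v)%:R) by rewrite ler_wpM2l.
    move: IH; rewrite !mulrDr !natrD !mulrDr. 
    by lra.
  - have w0 : 0 <= d * ((a != true)%:R : R) by rewrite mulr_ge0.
    have w1 : 0 <= d * ((E u)%:R : R) by rewrite mulr_ge0.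
    move: IH (l0 v); rewrite !mulrDr !natrD !mulrDr. lra.
  - have w0 : 0 <= d * ((a != false)%:R : R) by rewrite mulr_ge0.
    have w1 : 0 <= d * ((E v)%:R : R) by rewrite mulr_ge0.
    move: IH (l0 u); rewrite !mulrDr !natrD !mulrDr. lra.
  - have w0 : 0 <= d * ((a != false)%:R : R) by rewrite mulr_ge0.
    move: IH; rewrite !mulrDr !natrD !mulrDr. lra.
move=> _ IH.
have w0 : 0 <= d * ((a != x)%:R : R) by rewrite mulr_ge0.
have w1 : 0 <= d * ((E u)%:R : R) by rewrite mulr_ge0.
have w2 : 0 <= d * ((E v)%:R : R) by rewrite mulr_ge0.
have w3 : 0 <= d * ((x != y)%:R : R) by rewrite mulr_ge0.
have lu := l0 u; have lv := l0 v.
move: IH w0 w3; case: x; case: y => /= IH w0 w3; rewrite ?big_cons !natrD /=;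
  move: IH; rewrite !natrD !mulrDr; lra.
Qed.

Lemma npairs_flip (b1 b2 : seq bool) :
  `|(npairs (fun x y : bool => (x != y) : nat) (b1 ++ true :: b2))%:R -
    (npairs (fun x y : bool => (x != y) : nat) (b1 ++ false :: b2))%:R| <= 1 :> R.
Proof.
elim/seq_ind2: b1 => [|u|u v b1 IH] /=.
- by case: b2 => [|[] b2] /=; rewrite ?natrD ler_norml /=; lra.
- by case: u => /=; rewrite ?natrD ler_norml /=; lra.
- by rewrite !natrD opprD addrACA subrr add0r.
Qed.

Lemma avg_npairs r :
  avg (r.*2) (fun b => (npairs (fun x y : bool => (x != y) : nat) b)%:R) = r%:R / 2 :> R.
Proof.
elim: r => [|r IH] /=; first by rewrite mul0r.
rewrite IH.
under (eq_avg (g := fun b => (true + _)%:R)) do rewrite natrD.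
rewrite !avgD !avg_cst IH; rewrite -[r.+1%:R]natr1 /=; lra.
Qed.

End Accounting.

Lemma near1_range x0 s x : path near1 x0 s -> x \in s -> (`|x - x0| <= (size s)%:Z)%R.
Proof.
elim: s x0 => //= y s IH x0 /andP[yx0 ps]; rewrite inE => /orP[/eqP->|xs].
  by move: yx0; rewrite /near1; lia.
by have := IH _ ps xs; move: yx0; rewrite /near1; lia.
Qed.

Definition window (n : nat) : seq int := [seq (i%:Z - n%:Z)%R | i <- iota 0 (n.*2.+1)].

Lemma mem_window n x : `|x| <= n%:Z -> x \in window n.
Proof.
move=> xn; apply/mapP; exists `|(x + n%:Z)%R|%N; last by lia.
by rewrite mem_iota; lia.
Qed.

Section Loss.
Context {R : realType}.
Implicit Types (c : R) (f : int -> R) (b : seq bool) (s : seq int).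

Definition sgn (a : bool) : R := if a then 1 else -1.

Definition ell c f (u : bool * int) : R := c + sgn u.1 * f u.2.

Definition loss c f (st : seq (bool * int)) : R := \sum_(u <- st) ell c f u.

(** The sign at time i >= 1 is bit i - 1; the default of [nth] is not reached when [b] has length
    [n]. Adding [c * n%:R] makes every term of the action a nonnegative loss. *)
Definition mloss c f (n k : nat) b : R :=
  c * n%:R + min_action (fun i => sgn (nth true b `|i|.-1)) f n k%:Z.

Lemma ell_ge0 c f u : (forall x, `|f x| <= c) -> 0 <= ell c f u.
Proof.
by move=> /(_ u.2); rewrite ler_norml /ell /sgn => /andP[h1 h2]; case: u.1; lra.
Qed.

Lemma natr_sum_ord c n : c * n%:R = \sum_(i < n) c.
Proof. by rewrite sumr_const card_ord mulr_natr. Qed.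

Lemma action_loss c f n b g : size b = n ->
  c * n%:R + action (fun i => sgn (nth true b `|i|.-1)) f n g =
  loss c f (zip b (mkseq (fun i => g i.+1) n)).
Proof.
move=> sb; rewrite /action /loss big_add1 /= (big_nth (true, 0)) size_zip size_mkseq sb minnn.
rewrite !big_mkord natr_sum_ord -big_split.
apply: eq_bigr => i _; rewrite nth_zip ?size_mkseq // nth_mkseq //.
Qed.

Lemma action_lb c f n b g : (forall x, `|f x| <= c) ->
  - (c * n%:R) <= action (fun i => sgn (nth true b `|i|.-1)) f n g.
Proof.
move=> fc; rewrite /action big_add1 /= big_mkord natr_sum_ord -sumrN; apply: ler_sum => i _.
by have := ell_ge0 (nth true b i, g i.+1) fc; rewrite /ell /=; lra.
Qed.

(** Walks are handled as lists of their positions at times 1, ..., n; the starting point 0 is the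
    implicit head of [path]. *)
Lemma lwalk_seq n k g : lazy_walk n k g ->
  path near1 0 (mkseq (fun i => g i.+1) n) /\
  last 0 (mkseq (fun i => g i.+1) n) = k.
Proof.
case=> g0 [gn gl]; split.
  apply/(pathP 0) => i; rewrite size_mkseq => ni.
  rewrite nth_mkseq //; case: i ni => [|i] ni /=.
    by have := gl _ ni; rewrite g0.
  by rewrite nth_mkseq ?(ltnW ni) //; exact: gl.
case: n gn {gl} => [|n] gn; first by rewrite /= -gn g0.
by rewrite -nth_last size_mkseq nth_mkseq.
Qed.

Lemma seq_lwalk s k : path near1 0 s -> last 0 s = k ->
  lazy_walk (size s) k (fun i => nth 0 (0 :: s) i).
Proof.
move=> ps lk; split=> //; split; first by rewrite nth_last.
by move=> i ni; have /(pathP 0)/(_ i ni) := ps.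
Qed.

Lemma mloss_le c f n k b s : (forall x, `|f x| <= c) ->
  size b = n -> size s = n -> path near1 0 s -> last 0 s = k%:Z ->
  mloss c f n k b <= loss c f (zip b s).
Proof.
move=> fc sb ss ps ls.
have -> : s = mkseq (fun i => nth 0 (0 :: s) i.+1) n.
  apply: (@eq_from_nth _ 0); rewrite ?size_mkseq // => i; rewrite ss => si.
  by rewrite nth_mkseq.
rewrite -action_loss // lerD2l; apply: ge_inf.
  by exists (- (c * n%:R)) => _ [g _ <-]; exact: action_lb.
by exists (fun i => nth 0 (0 :: s) i) => //=; rewrite -ss; exact: seq_lwalk.
Qed.

Lemma lazy_walk_ex n k : (k <= n)%N -> exists g, lazy_walk n k%:Z g.
Proof.
move=> kn; exists (fun i => (minn i k)%:Z); split; first by rewrite min0n.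
by split=> [|i _]; lia.
Qed.

Lemma mloss_adherent c f n k b e : (forall x, `|f x| <= c) -> 0 < e ->
  size b = n -> (k <= n)%N ->
  exists s, [/\ size s = n, path near1 0 s, last 0 s = k%:Z &
    loss c f (zip b s) <= mloss c f n k b + e].
Proof.
move=> fc e0 sb kn.
pose A := [set action (fun i => sgn (nth true b `|i|.-1)) f n g | g in [set g | lazy_walk n k%:Z g]].
have iA : has_inf A.
  split; last by exists (- (c * n%:R)) => _ [g _ <-]; exact: action_lb.
  by have [g gl] := lazy_walk_ex kn; exists (action (fun i => sgn (nth true b `|i|.-1)) f n g), g.
have [_ [g /= gl <-] lt] := inf_adherent e0 iA.
have [p l] := lwalk_seq gl.
exists (mkseq (fun i => g i.+1) n); rewrite size_mkseq; split => //.
by rewrite -action_loss // /mloss -addrA lerD2l; exact: ltW.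
Qed.

Lemma loss_ge0 c f st : (forall x, `|f x| <= c) -> 0 <= loss c f st.
Proof. by move=> fc; apply: sumr_ge0 => u _; exact: ell_ge0. Qed.

Lemma mloss_ge0 c f n k b : (forall x, `|f x| <= c) ->
  size b = n -> (k <= n)%N -> 0 <= mloss c f n k b.
Proof.
move=> fc sb kn; apply/ler_addgt0Pr => e e0.
have [s [_ _ _]] := mloss_adherent fc e0 sb kn.
exact/le_trans/loss_ge0.
Qed.

(** A nearly optimal walk for one string competes for the other string, and along it a single term
    changes, by at most 2 c. This is the hypothesis of the bounded-differences inequality. *)
Lemma mloss_flip c f n k b1 b2 : (forall x, `|f x| <= c) -> (k <= n)%N ->
  (size b1 + size b2).+1 = n ->
  `|mloss c f n k (b1 ++ true :: b2) - mloss c f n k (b1 ++ false :: b2)| <= 2 * c.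
Proof.
move=> fc kn sb.
have zE s : size s = n -> exists (s1 : R) (x : int) (s2 : R),
    loss c f (zip (b1 ++ true :: b2) s) = s1 + ell c f (true, x) + s2 /\
    loss c f (zip (b1 ++ false :: b2) s) = s1 + ell c f (false, x) + s2.
  move=> ss; have sz : s = take (size b1) s ++ nth 0 s (size b1) :: drop (size b1).+1 s.
    by rewrite -drop_nth ?cat_take_drop // ss -sb ltnS leq_addr.
  exists (loss c f (zip b1 (take (size b1) s))), (nth 0 s (size b1)),
    (loss c f (zip b2 (drop (size b1).+1 s))).
  have st : size b1 = size (take (size b1) s) by rewrite size_takel // ss -sb; lia.
  by split; rewrite {1}sz zip_cat // /loss big_cat /= big_cons addrA.
have key a a' : mloss c f n k (b1 ++ a :: b2) <= mloss c f n k (b1 ++ a' :: b2) + 2 * c.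
  apply/ler_addgt0Pr => e e0.
  have sab d : size (b1 ++ d :: b2) = n by rewrite size_cat /= addnS.
  have [s [ss ps ls hl]] := mloss_adherent fc e0 (sab a') kn.
  have := mloss_le fc (sab a) ss ps ls.
  have [s1 [x [s2 [e1 e2]]]] := zE s ss.
  move: hl; have := fc x; rewrite ler_norml => /andP[fx1 fx2].
  by case: a; case: a' {sab}; rewrite ?e1 ?e2 /ell /sgn /=; lra.
by rewrite ler_norml; have := key true false; have := key false true; lra.
Qed.

(** The walk stands still at its endpoint for the [p] extra steps, each of which loses at most 2
    c. *)
Lemma mloss_cat c f n p k b b' : (forall x, `|f x| <= c) -> (k <= n)%N ->
  size b = n -> size b' = p ->
  mloss c f (n + p) k (b ++ b') <= mloss c f n k b + 2 * c * p%:R.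
Proof.
move=> fc kn sb sb'; apply/ler_addgt0Pr => e e0.
have [s [ss ps ls hl]] := mloss_adherent fc e0 sb kn.
have h := @mloss_le c f (n + p) k (b ++ b') (s ++ nseq p k%:Z) fc.
apply: (le_trans (h _ _ _ _)); rewrite ?size_cat ?size_nseq ?sb ?sb' ?ss //.
- rewrite cat_path ps ls; elim: (p) => //= q IH; rewrite IH andbT.
  by rewrite /near1 subrr normr0.
- by rewrite last_cat ls; elim: (p).
rewrite zip_cat ?ss // /loss big_cat /= addrAC; apply: lerD; first exact: hl.
rewrite (big_nth (true, 0)) size_zip size_nseq sb' minnn natr_sum_ord big_mkord.
apply: ler_sum => i _.
rewrite nth_zip ?size_nseq // /ell /= nth_nseq ltn_ord.
by have := fc k%:Z; rewrite ler_norml /sgn => /andP[fx1 fx2]; case: (nth _ _ _); lra.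
Qed.

End Loss.

Lemma mask_zip (T T' : Type) (m : bitseq) (s : seq T) (s' : seq T') :
  size s = size s' -> mask m (zip s s') = zip (mask m s) (mask m s').
Proof.
elim: m s s' => [|a m IH] [|x s] [|y s'] //=.
by move=> [/IH ->]; case: a.
Qed.

(** * Entropy of masks and atypical sign strings *)

Section Core.
Context {R : realType}.

(** For a uniform mask the switches are independent fair coins. *)
Lemma avg_sw n (x : R) a : avg n (fun m => x ^+ sw a m) = ((1 + x) / 2) ^+ n.
Proof.
elim: n a => //= n IH a; rewrite exprS -(IH true).
rewrite (_ : avg n _ = avg n (fun m => x ^+ (a != true) * x ^+ sw true m)); last first.
  by apply: eq_avg => b _; rewrite exprD.
rewrite [X in _ + X](_ : _ = avg n (fun m => x ^+ (a != false) * x ^+ sw false m)); last first.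
  by apply: eq_avg => b _; rewrite exprD.
rewrite !avgZ !IH; case: a; rewrite /= !expr0 !expr1; lra.
Qed.

(** The mask is quantified inside the event because the cut will depend on the signs. The bound on
    [count id m] keeps the endpoint [k] within reach. *)
Definition atypical (c : R) (f : int -> R) n k K (e : R) (b : seq bool) : Prop :=
  exists m, [/\ size m = n, (sw true m <= K)%N, (k <= count id m)%N &
    mloss c f (count id m) k (mask m b) <
      avg (count id m) (mloss c f (count id m) k) - e].

Lemma le_avg_bigU (I : eqType) (r : seq I) (Q : I -> seq bool -> Prop) n :
  avg n (fun b => (`[< exists2 i, i \in r & Q i b >])%:R : R) <=
  \sum_(i <- r) avg n (fun b => (`[< Q i b >])%:R).
Proof.
rewrite -avg_sum; apply: le_avg => b _.
case: asboolP => [[i ir Qi]|_] /=; last by apply: sumr_ge0.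
rewrite (big_rem i) //= asboolT //= lerDl; exact: sumr_ge0.
Qed.

Lemma avg_asbool0 n (Q : seq bool -> Prop) : (forall b, ~ Q b) ->
  avg n (fun b => (`[< Q b >])%:R) = 0 :> R.
Proof. by move=> nQ; rewrite -[RHS](avg_cst n); apply: eq_avg => b _; rewrite asboolF. Qed.

(** Generating function of the masks by number of switches. For 0 < x <= 1 it bounds the number of
    masks with at most K switches by x^-K (1 + x)^n, which replaces estimates of binomial sums. *)
Lemma sum_bits_sw n (x : R) : \sum_(m <- bits n) x ^+ sw true m = (1 + x) ^+ n.
Proof.
have := avg_sw n x true; rewrite avgE expr_div_n.
by apply: mulIf; rewrite invr_eq0 expf_neq0.
Qed.

(** Union bound over masks. For a fixed mask, [avg_mask] reduces the event to a deviation on a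
    smaller cube; the weight x^-K x^(sw) is at least 1 on the admissible masks and sums to the
    stated prefactor. *)
Lemma avg_atypical c f n k K e (x l : R) :
  (forall y, `|f y| <= c) -> 0 < x <= 1 -> 0 <= l ->
  avg n (fun b => (`[< atypical c f n k K e b >])%:R) <=
  x ^- K * (1 + x) ^+ n * expR (2 * l ^+ 2 * c ^+ 2 * n%:R - l * e).
Proof.
move=> fc /andP[x0 x1] l0.
pose Q m b := [/\ (sw true m <= K)%N, (k <= count id m)%N &
    mloss c f (count id m) k (mask m b) <
      avg (count id m) (mloss c f (count id m) k) - e].
apply: (@le_trans _ _ (\sum_(m <- bits n) avg n (fun b => (`[< Q m b >])%:R))).
  apply: (le_trans _ (le_avg_bigU _ _ _)).
  apply: le_avg => b _; rewrite ler_nat; case: asboolP => // -[m [sm h1 h2 h3]].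
  by rewrite asboolT //; exists m; rewrite ?mem_bits ?sm.
set A := expR _.
apply: (@le_trans _ _ (\sum_(m <- bits n) x ^- K * A * x ^+ sw true m)).
  rewrite [leLHS]big_seq [leRHS]big_seq; apply: ler_sum => m; rewrite mem_bits => /eqP sm.
  have A0 : 0 < A by exact: expR_gt0.
  have [swK|swK] := leqP (sw true m) K; last first.
    rewrite avg_asbool0; first by rewrite !mulr_ge0 ?invr_ge0 ?exprn_ge0 // ltW.
    by move=> b []; rewrite leqNgt swK.
  have [kc|kc] := leqP k (count id m); last first.
    rewrite avg_asbool0; first by rewrite !mulr_ge0 ?invr_ge0 ?exprn_ge0 // ltW.
    by move=> b [_ + _]; rewrite leqNgt kc.
  apply: (@le_trans _ _ A).
    set N := count id m.
    apply: (@le_trans _ _ (avg (size m) (fun b =>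
        (mloss c f N k (mask m b) < avg N (mloss c f N k) - e)%R%:R))).
      rewrite sm; apply: le_avg => b _; rewrite ler_nat.
      by case: asboolP => // -[_ _ ->].
    rewrite (avg_mask m (fun b => (mloss c f N k b < avg N (mloss c f N k) - e)%R%:R)).
    apply: (le_trans (avg_dev e l0 _)) => [b1 b2 sb|]; first exact: mloss_flip.
    have h0 : 0 <= 2 * l ^+ 2 * c ^+ 2 by apply: mulr_ge0; [apply: mulr_ge0 => //|]; exact: sqr_ge0.
    rewrite ler_expR lerD2r; apply: ler_wpM2l => //.
    by rewrite ler_nat -sm count_size.
  rewrite mulrAC -[leLHS]mul1r ler_pM2r // mulrC ler_pdivlMr ?exprn_gt0 // mul1r.
  by rewrite ler_wiXn2l // ltW.
by rewrite -mulr_sumr sum_bits_sw mulrAC.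
Qed.

End Core.

(** * Removing the time spent at good bonds *)

Lemma near1_last x0 s : path near1 x0 s -> `|last x0 s - x0| <= (size s)%:Z.
Proof.
case: s => [|y s] ps; first by rewrite /= subrr normr0.
by apply: near1_range ps _; rewrite /= mem_last.
Qed.

Section Core.
Context {R : realType}.
Implicit Types (c : R) (f : int -> R) (b : seq bool) (s : seq int).

(** Loop erasure at the sites of [E] gives a shorter lazy walk to the same endpoint, whose mask has
    at most [2 * size E] switches, so typicality bounds its loss from below. The term [3 * size E]
    collects these switches and the at most [size E] surviving visits to [E]. *)
Lemma cut_step c f n k b s (E : seq int) (G : bool * int -> bool * int -> nat) (d e : R) :
  (forall x, `|f x| <= c) -> size b = n -> size s = n -> path near1 0 s ->
  last 0 s = k%:Z -> 0 <= d ->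
  (forall u v, (0 < G u v)%N ->
    [/\ G u v = 1%N, d <= ell c f u + ell c f v & (u.2 \in E) || (v.2 \in E)]) ->
  ~ atypical c f n k (2 * size E) e b ->
  exists n', [/\ (k <= n' <= n)%N,
    avg n' (mloss c f n' k) - e + d * (npairs G (zip b s))%:R <=
      loss c f (zip b s) + d * (3 * size E)%:R &
    (n' + 2 * npairs G (zip b s) <= n + 2 * (3 * size E))%N].
Proof.
move=> fc sb ss ps ls d0 HG typ.
have [m [sm swm pm lm cm]] := loop_erasure E ps.
have smz : size m = size (zip b s) by rewrite size_zip sb sm ss minnn.
have szc (T : Type) (t : seq T) : size t = n -> size (mask m t) = count id m.
  by move=> st; rewrite size_mask // sm ss st.
have kn' : (k <= count id m)%N.
  by have := near1_last pm; rewrite lm ls subr0 szc //; lia.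
have cE : (count (fun u : bool * int => u.2 \in E) (mask m (zip b s)) <= size E)%N.
  rewrite mask_zip ?sb ?ss //.
  rewrite -(count_map snd (mem E)) -/unzip2 unzip2_zip //.
  by rewrite !szc.
have cost : (sw true m + count (fun u : bool * int => u.2 \in E) (mask m (zip b s)) <= 3 * size E)%N.
  by lia.
exists (count id m); split.
- by rewrite kn' -ss -sm count_size.
- have := npairs_mask (l := ell c f) (E := fun u => u.2 \in E) true d0 (fun u => ell_ge0 u fc) HG smz.
  have h1 : avg (count id m) (mloss c f (count id m) k) - e <=
      loss c f (mask m (zip b s)).
    rewrite mask_zip ?sb ?ss //.
    apply: (@le_trans _ _ (mloss c f (count id m) k (mask m b))).
      rewrite leNgt; apply/negP => lt; apply: typ; exists m; split => //.
      by rewrite sm.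
    by apply: mloss_le => //; rewrite ?szc // lm.
  have h2 : d * (sw true m + count (fun u : bool * int => u.2 \in E) (mask m (zip b s)))%:R
    <= d * (3 * size E)%:R by rewrite ler_wpM2l // ler_nat.
  by rewrite -/(loss c f _) -/(loss c f _) => h3; lra.
(* The same accounting with unit weights and [d = 2] measures time instead of loss: a deleted pair
   saves two steps. *)
- have HG2 u v : (0 < G u v)%N -> [/\ G u v = 1%N, 2%:R <= (1 + 1 : R) & (u.2 \in E) || (v.2 \in E)].
    by case/HG.
  have := npairs_mask (l := fun=> 1) (E := fun u : bool * int => u.2 \in E) true (ler0n R 2) (fun=> ler01) HG2 smz.
  rewrite !big_const_seq !count_predT !iter_addr !addr0 size_mask //.
  rewrite size_zip sb ss minnn -!natrM -!natrD ler_nat; lia.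
Qed.

Definition gap c f (x : int) : R := 2 * c - `|f x - f (x + 1)|.

(** A bond is recorded by its left end: a pair of steps using the bond visits that site, so it is
    enough to cut at sites. *)
Definition good_sites c f (h : R) (n : nat) : seq int :=
  [seq x <- window n | gap c f x < h].

Definition alt (u v : bool * int) : nat := (u.1 != v.1).

Definition level_pair c f (lo hi : R) (E : seq int) (u v : bool * int) : nat :=
  [&& u.1 != v.1, lo <= ell c f u + ell c f v, ell c f u + ell c f v < hi &
   (u.2 \in E) || (v.2 \in E)].

(** Two opposite signs lose exactly 2 c at a single site, which [h <= 2 * c] rules out, and 2 c plus
    or minus the difference of [f] at the two ends of a bond, hence at least the gap. *)
Lemma alt_gap c f (h : R) u v : h <= 2 * c -> near1 u.2 v.2 -> u.1 != v.1 ->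
  ell c f u + ell c f v < h -> gap c f u.2 < h \/ gap c f v.2 < h.
Proof.
case: u => a x; case: v => a' y /= hc nxy aa'.
have [->|[->|->]] : y = x \/ y = x + 1 \/ x = y + 1.
- by move: nxy; rewrite /near1; lia.
- by case: a aa'; case: a' => // _; rewrite /ell /sgn /=; lra.
- move=> lt; left; apply: le_lt_trans lt; rewrite /gap /ell /= /sgn.
  have := ler_norm (f x - f (x + 1)); have := ler_norm (- (f x - f (x + 1))).
  by rewrite normrN; case: a aa'; case: a' => // _; lra.
- move=> lt; right; apply: le_lt_trans lt; rewrite /gap /ell /= /sgn.
  have := ler_norm (f y - f (y + 1)); have := ler_norm (- (f y - f (y + 1))).
  by rewrite normrN; case: a aa'; case: a' => // _; lra.
Qed.

Lemma npairs_loss (T : Type) (l : T -> R) (G : T -> T -> nat) (d : R) (s : seq T) :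
  0 <= d -> (forall u, 0 <= l u) ->
  (forall u v, (0 < G u v)%N -> G u v = 1%N /\ d <= l u + l v) ->
  d * (npairs G s)%:R <= \sum_(u <- s) l u.
Proof.
move=> d0 l0 HG; elim/seq_ind2: s => [|u|u v s IH] /=.
- by rewrite mulr0 big_nil.
- by rewrite mulr0 big_seq1.
rewrite !big_cons natrD mulrDr addrA; apply: lerD => //.
have := HG u v; case: (G u v) => [|p] h; first by rewrite mulr0 addr_ge0.
by have [// | -> ?] := h; rewrite mulr1.
Qed.

(** The location of [w] among the thresholds is put in the form of a count, which can be summed over
    pairs. *)
Lemma levels_cover (hh : nat -> R) (w : R) (j0 J : nat) : (j0 <= J)%N ->
  (1 <= (hh j0 <= w)%R + \sum_(j0 <= j < J) (hh j.+1 <= w < hh j)%R + (w < hh J)%R)%N.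
Proof.
move=> /subnK <-; elim: (J - j0)%N => [|p IH].
  by rewrite add0n big_geq // addn0; case: leP.
rewrite addSn big_nat_recr /= ?leq_addl //.
move: IH; set S := \sum_(_ <= j < _) _; move: S => S.
case: (ltP w (hh (p + j0)%N)) => _; case: (leP (hh (p + j0).+1) w) => _ /=; lia.
Qed.

Lemma alt_levels c f (hh : nat -> R) (j0 J n : nat) b s :
  (forall j, (j0 <= j <= J)%N -> hh j <= 2 * c) -> (j0 <= J)%N ->
  (forall x, `|f x| <= c) ->
  size b = n -> size s = n -> path near1 0 s ->
  (npairs alt (zip b s) <=
    npairs (fun u v => ((u.1 != v.1) && (hh j0 <= ell c f u + ell c f v)%R : nat)) (zip b s) +
    \sum_(j0 <= j < J) npairs (level_pair c f (hh j.+1) (hh j) (good_sites c f (hh j) n)) (zip b s) +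
    npairs (level_pair c f 0 (hh J) (good_sites c f (hh J) n)) (zip b s))%N.
Proof.
move=> hc jJ fc sb ss ps.
rewrite -npairs_sum -!npairsD.
have pz : path (fun u v : bool * int => near1 u.2 v.2) (true, 0) (zip b s).
  have : path near1 0 (unzip2 (zip b s)) by rewrite unzip2_zip // sb ss.
  by move: (zip b s) (0 : int) (true) => z; elim: z => //= -[a' y] z IH x a /= /andP[-> h] /=; exact: IH.
apply: le_npairs_path pz _ => u v uz vz nuv; rewrite /alt /level_pair.
have [|_] := boolP (u.1 != v.1) => //= uv.
have inE w : w \in zip b s -> w.2 \in window n.
  case: w => a x /(map_f snd); rewrite -/unzip2 unzip2_zip ?sb ?ss // => xs.
  by apply: mem_window; have := near1_range ps xs; rewrite subr0 ss.
have good h : h <= 2 * c -> ell c f u + ell c f v < h ->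
    (u.2 \in good_sites c f h n) || (v.2 \in good_sites c f h n).
  move=> h2 lt; rewrite !mem_filter !inE // !andbT.
  by apply/orP; exact: alt_gap lt.
have w0 : 0 <= ell c f u + ell c f v by rewrite addr_ge0 // ell_ge0.
apply: (leq_trans (levels_cover hh (ell c f u + ell c f v) jJ)).
apply: leq_add; last first.
  by rewrite w0 /=; case: ltP => //= /good ->; rewrite ?hc ?jJ ?leqnn.
rewrite leq_add2l !big_seq; apply: leq_sum => j; rewrite mem_index_iota => /andP[h1 h2].
case: (leP (hh j.+1) _) => //= _; case: ltP => //= /good -> //.
by rewrite hc // h1 ltnW.
Qed.

End Core.

(** * Comparison of two slopes in a frozen environment *)

Section Core.
Context {R : realType}.
Implicit Types (c : R) (f : int -> R) (b : seq bool) (s : seq int).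

(* With th = 2^(-kappa/4), bonds of gap < 2^-j have density O(4^-j th^(8j)), so mu bounds their
   empirical frequency by Markov's inequality; eta is the deviation that beats the entropy of
   choosing 2 mu n cutting times among n. *)
Definition mu (th : R) j : R := (1 / 4) ^+ j * th ^+ (4 * j).
Definition eta (th : R) j : R := (1 / 2) ^+ j * th ^+ j.

Lemma mu_le (th : R) j : 0 < th < 1 -> mu th j <= th ^+ j.
Proof.
move=> /andP[t0 t1]; rewrite /mu -[leRHS]mul1r; apply: ler_pM.
- by rewrite exprn_ge0; lra.
- by rewrite exprn_ge0 // ltW.
- by rewrite exprn_ile1; lra.
- by apply: ler_wiXn2l; [exact: ltW|exact: ltW|lia].
Qed.

(** [V] stands for the loss expected at time n, and [V'] for a lower bound on the expected loss over
    all times up to 15/16 n with the same endpoint, that is, at larger slopes. The walk is cut at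
    each level in turn to show that intermediate levels take little time, and a last time at level
    [J]. *)
Lemma slope_comparison c (th : R) (j0 J r k : nat) f (V V' xi : R) :
  let n := r.*2 in
  0 < th < 1 -> (j0 <= J)%N -> (forall x, `|f x| <= c) -> (k <= n)%N -> (0 < n)%N ->
  (1 / 2) ^+ j0 <= 2 * c ->
  (forall n', (k <= n' <= n)%N -> V - xi <= avg n' (mloss c f n' k)) ->
  (forall n', (k <= n' <= n)%N -> n'%:R <= 15 / 16 * n%:R :> R ->
     V' - xi <= avg n' (mloss c f n' k)) ->
  avg n (fun b => (V + xi < mloss c f n k b)%R%:R) <= 1 / 4 :> R ->
  (forall j, (j0 <= j <= J)%N ->
     (size (good_sites c f ((1 / 2) ^+ j) n))%:R <= mu th j * n%:R) ->
  \sum_(j0 <= j < J.+1) avg n (fun b => (`[< atypical c f n k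
     (2 * size (good_sites c f ((1 / 2) ^+ j) n)) (eta th j * n%:R) b >])%:R) <= 1 / 4 :> R ->
  avg n (fun b => ((npairs (fun x y : bool => (x != y) : nat) b)%:R < n%:R / 8 :> R)%R%:R)
     <= 1 / 4 :> R ->
  0 < xi -> (forall j, (j0 <= j <= J)%N -> 3 * xi < eta th j * n%:R) ->
  V + 2 * xi <= (1 / 2) ^+ j0 * (n%:R / 32) ->
  \sum_(j0 <= j < J) 8 * th ^+ j <= 1 / 32 ->
  mu th J <= 1 / 96 ->
  V' <= V + eta th J * n%:R + 3 * xi.
Proof.
move=> n th01 jJ fc kn n0 hc Hm1 Hm2 Hup Hcount Hdev Halt xi0 Hxi HV Htail Hmu.
have nR : 0 < n%:R :> R by rewrite ltr0n.
(* Three bad events of frequency at most 1/4 each leave a sign string outside all of them. *)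
have [b sb [/negP up /negP al typ]] : exists2 b, size b = n &
  [/\ ~~ (V + xi < mloss c f n k b)%R,
    ~~ ((npairs (fun x y : bool => (x != y) : nat) b)%:R < n%:R / 8 :> R)%R &
    forall j, (j0 <= j <= J)%N -> ~ atypical c f n k
     (2 * size (good_sites c f ((1 / 2) ^+ j) n)) (eta th j * n%:R) b].
  rewrite -avg_sum in Hdev.
  have := lerD (lerD Hup Halt) Hdev; rewrite -!avgD => Hsum.
  have q1 : 1 / 4 + 1 / 4 + 1 / 4 < 1 :> R by lra.
  have [b sb lt1] := avg_lt_ex (le_lt_trans Hsum q1).
  exists b => //; move: lt1; set A := (V + xi < _)%R; set B := (_ < n%:R / 8)%R; set S := (X in _ + X < 1).
  have S0 : 0 <= S by apply: sumr_ge0.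
  have A0 : 0 <= A%:R :> R by []. have B0 : 0 <= B%:R :> R by [].
  move=> lt1.
  split.
  - by apply/negP => hA; move: lt1; rewrite hA /=; lra.
  - by apply/negP => hB; move: lt1; rewrite hB /=; lra.
  move=> j jj ty; have : 1 <= S; last by lra.
  rewrite /S (bigD1_seq j) /= ?iota_uniq ?mem_index_iota ?ltnS //.
  by rewrite asboolT // lerDl; apply: sumr_ge0.
have [s [ss ps ls hl]] := mloss_adherent fc xi0 sb kn.
have lV : loss c f (zip b s) <= V + 2 * xi.
  move/negP: up; rewrite -leNgt; lra.
have h0 j : 0 < (1 / 2) ^+ j :> R by rewrite exprn_gt0.
have hdec j : (j0 <= j)%N -> (1 / 2) ^+ j <= (1 / 2) ^+ j0 :> R.
  by move=> ?; apply: ler_wiXn2l => //; lra.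
have th0 j : 0 < th ^+ j by rewrite exprn_gt0 //; case/andP: th01.
pose T j := npairs (level_pair c f ((1 / 2) ^+ j.+1) ((1 / 2) ^+ j)
   (good_sites c f ((1 / 2) ^+ j) n)) (zip b s).
have HG lo hi E u v : (0 < level_pair c f lo hi E u v)%N ->
    [/\ level_pair c f lo hi E u v = 1%N, lo <= ell c f u + ell c f v & (u.2 \in E) || (v.2 \in E)].
  by rewrite /level_pair; case: and4P => // -[].
(* Write h = 2^-j and t = th^j. If [T j] exceeded 8 t n, cutting at level [j] would save more than 4
   h t n, against a deviation h t n and a cost of at most 3/2 h t n. The surplus 3/2 h t n cannot
   fit into the slack 3 xi < h t n. *)
have small j : (j0 <= j < J)%N -> (T j)%:R <= 8 * th ^+ j * n%:R.
  move=> /andP[j1 j2]; have jj : (j0 <= j <= J)%N by rewrite j1 ltnW.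
  rewrite leNgt; apply/negP => big.
  have [n' [kn' + _]] := cut_step fc sb ss ps ls (ltW (h0 j.+1)) (@HG _ ((1 / 2) ^+ j) _) (typ j jj).
  rewrite -/(T j) => cut; have m1 := Hm1 _ kn'; have ct := Hcount j jj; have xj := Hxi j jj.
  have ct' : (size (good_sites c f ((1 / 2) ^+ j) n))%:R <= th ^+ j * n%:R.
    by apply: (le_trans ct); rewrite ler_pM2r //; exact: mu_le.
  move: cut xj; rewrite /eta natrM [_ ^+ j.+1]exprS; have hj := h0 j.
  move: big ct'; set h := (1/2) ^+ j in hj *; set t := th ^+ j.
  move=> big ct' cut xj.
  have e1 : h * (8 * t * n%:R) < h * (T j)%:R by rewrite ltr_pM2l.
  have e2 : h * (size (good_sites c f h n))%:R <= h * (t * n%:R) by rewrite ler_pM2l.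
  nra.
have JJ : (j0 <= J <= J)%N by rewrite jJ leqnn.
have hcj j : (j0 <= j <= J)%N -> (1 / 2) ^+ j <= 2 * c.
  by move=> /andP[j1 _]; apply: le_trans hc; exact: hdec.
have lev := alt_levels hcj jJ fc sb ss ps.
set Nb := npairs (fun u v => _ && _ : nat) _ in lev.
set TJ := npairs (level_pair c f 0 _ _) _ in lev.
(* Each of these pairs loses at least 2^-j0, out of a total of at most V + 2 xi. *)
have bad : Nb%:R <= n%:R / 32 :> R.
  suff : (1 / 2) ^+ j0 * Nb%:R <= (1 / 2) ^+ j0 * (n%:R / 32) :> R by rewrite ler_pM2l.
  apply: le_trans HV; apply: le_trans lV.
  apply: npairs_loss; [exact: ltW|by move=> u; exact: ell_ge0|].
  by move=> u v; case: andP => // -[_ ?].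
have tl : (\sum_(j0 <= j < J) T j)%N%:R <= n%:R / 32 :> R.
  rewrite natr_sum; apply: (@le_trans _ _ (\sum_(j0 <= j < J) 8 * th ^+ j * n%:R)).
    rewrite !big_seq; apply: ler_sum => j; rewrite mem_index_iota; exact: small.
  rewrite -mulr_suml mulrC -[_ / 32]/(_ * _); rewrite ler_pM2l //; lra.
have alt8 : n%:R / 8 <= (npairs alt (zip b s))%:R :> R.
  move/negP: al; rewrite -leNgt => al; apply: (le_trans al).
  rewrite -{1}(unzip1_zip (s := b) (t := s)) ?sb ?ss //.
  by rewrite /unzip1 npairs_map.
(* Of the n/8 alternating pairs, at most n/32 lie above all levels and at most n/32 at the
   intermediate ones. *)
have TJ16 : n%:R / 16 <= TJ%:R :> R.
  have : (npairs alt (zip b s))%:R <= (Nb + \sum_(j0 <= j < J) T j + TJ)%N%:R :> R.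
    by rewrite ler_nat.
  rewrite !natrD; lra.
(* With [d = 0] no saving in loss is claimed; only time counts. At least n/8 of it is removed, up to
   the correction 6 n/96 = n/16, so at most 15/16 n remains. *)
have [n' [kn' cut sz]] := cut_step fc sb ss ps ls (lexx (0 : R)) (HG 0 ((1 / 2) ^+ J) (good_sites c f ((1 / 2) ^+ J) n)) (typ J JJ).
have ct : (size (good_sites c f ((1 / 2) ^+ J) n))%:R <= n%:R / 96 :> R.
  apply: (le_trans (Hcount J JJ)); rewrite mulrC ler_pM2l //; lra.
have n15 : n'%:R <= 15 / 16 * n%:R :> R.
  have : (n' + 2 * TJ)%N%:R <= (n + 2 * (3 * size (good_sites c f ((1 / 2) ^+ J) n)))%N%:R :> R.
    by rewrite ler_nat.
  rewrite (natrD _ n') (natrD _ n) !natrM; lra.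
have := Hm2 _ kn' n15; move: cut; rewrite !mul0r; lra.
Qed.

End Core.

(** * Numerical bounds and passage from a grid of lengths to all lengths *)

Section CoreEnv.
Context {R : realType}.
Implicit Types (c : R) (f : int -> R) (b : seq bool) (s : seq int).

Lemma expRN_le (x : R) : 0 < x -> expR (- x) <= x^-1.
Proof.
move=> x0; rewrite expRN lef_pV2 ?posrE ?expR_gt0 //.
by apply: le_trans (expR_ge1Dx x); lra.
Qed.

(** The mean over r disjoint pairs is r/2, twice the threshold r/4. Flipping a bit changes the count
    by at most 1; [l = 1/8] gives the exponent - r/64, and exp (- r/64) <= 64/r <= 1/4. *)
Lemma few_alternations (r : nat) : (256 <= r)%N ->
  avg r.*2 (fun b => ((npairs (fun x y : bool => (x != y) : nat) b)%:R < r.*2%:R / 8 :> R)%R%:R)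
     <= 1 / 4 :> R.
Proof.
move=> r256; set g := fun b => (npairs (fun x y : bool => (x != y) : nat) b)%:R : R.
have E : r.*2%:R / 8 = avg r.*2 g - r%:R / 4 :> R.
  by rewrite avg_npairs -muln2 natrM; lra.
rewrite E; have rR : 256 <= r%:R :> R by rewrite (ler_nat _ 256).
apply: (le_trans (@avg_dev R r.*2 g (1/2) (1/8) (r%:R/4) _ _)) => //.
  move=> b1 b2 _; rewrite mulrCA mulfV // mulr1; exact: npairs_flip.
rewrite (_ : _ - _ = - (r%:R / 64)); last by rewrite -muln2 natrM; field.
apply: le_trans (expRN_le _) _; first lra.
by rewrite invf_div ler_pdivrMr; lra.
Qed.

Lemma mu_gt0 (th : R) j : 0 < th -> 0 < mu th j.
Proof. by move=> t0; rewrite /mu mulr_gt0 // exprn_gt0. Qed.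

Lemma eta_gt0 (th : R) j : 0 < th -> 0 < eta th j.
Proof. by move=> t0; rewrite /eta mulr_gt0 // exprn_gt0. Qed.

Lemma eta_le (th : R) i j : 0 < th < 1 -> (i <= j)%N -> eta th j <= eta th i.
Proof.
move=> /andP[t0 t1] ij; rewrite /eta; apply: ler_pM.
- by rewrite exprn_ge0.
- by rewrite exprn_ge0 // ltW.
- by apply: ler_wiXn2l => //; lra.
- by apply: ler_wiXn2l => //; exact: ltW.
Qed.

Lemma mu_expR (th : R) j : 0 < th -> mu th j = expR (- (ln (4 / th ^+ 4) * j%:R)).
Proof.
move=> t0; rewrite expRN expRM_natr lnK ?posrE ?divr_gt0 ?exprn_gt0 //.
rewrite /mu exprM -exprMn -exprVn; congr (_ ^+ _); field.
by rewrite lt0r_neq0.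
Qed.

(* With l = eta / (4 c^2) the concentration exponent is - eta^2 n / (8 c^2), and the
   entropy of the masks uses at most half of it. *)
Lemma avg_atypical_level c f th n k K j :
  0 < c -> 0 < th < 1 -> (forall y, `|f y| <= c) -> (0 < n)%N ->
  K%:R <= 2 * (mu th j * n%:R) ->
  0 <= ln (4 / th ^+ 4) ->
  16 * c ^+ 2 * (2 * ln (4 / th ^+ 4) * j%:R + 1) * th ^+ (2 * j) <= 1 ->
  avg n (fun b => (`[< atypical c f n k K (eta th j * n%:R) b >])%:R) <=
    16 * c ^+ 2 / (eta th j ^+ 2 * n%:R).
Proof.
move=> c0 /andP[t0 t1] fc n0 hK lam0 hj.
set lam := ln _ in lam0 hj *.
have nR : 0 < n%:R :> R by rewrite ltr0n.
have m0 := mu_gt0 j t0; have e0 := eta_gt0 j t0.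
have m1 : 0 < mu th j <= 1.
  by rewrite m0 /= (le_trans (mu_le j _)) ?t0 // exprn_ile1 ?ltW.
have l0 : 0 <= eta th j / (4 * c ^+ 2) by rewrite divr_ge0 ?(ltW e0) // mulr_ge0 ?sqr_ge0.
apply: (le_trans (avg_atypical n k K (eta th j * n%:R) fc m1 l0)).
have -> : 2 * (eta th j / (4 * c ^+ 2)) ^+ 2 * c ^+ 2 * n%:R -
    eta th j / (4 * c ^+ 2) * (eta th j * n%:R) = - (eta th j ^+ 2 * n%:R / (8 * c ^+ 2)).
  by field; rewrite ?lt0r_neq0 //.
have -> : mu th j ^- K = expR (lam * j%:R * K%:R).
  by rewrite mu_expR // -exprVn -expRN opprK -expRM_natr.
have h1 : (1 + mu th j) ^+ n <= expR (mu th j * n%:R).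
  rewrite expRM_natr lerXn2r ?nnegrE ?expR_ge0 ?expR_ge1Dx // addr_ge0 // ltW //.
apply: (@le_trans _ _ (expR (- (eta th j ^+ 2 * n%:R / (16 * c ^+ 2))))); last first.
  have p0 : 0 < eta th j ^+ 2 * n%:R / (16 * c ^+ 2).
    by rewrite divr_gt0 // mulr_gt0 // exprn_gt0.
  by apply: le_trans (expRN_le p0) _; rewrite invf_div.
apply: (@le_trans _ _ (expR (lam * j%:R * K%:R) * expR (mu th j * n%:R) *
   expR (- (eta th j ^+ 2 * n%:R / (8 * c ^+ 2))))).
  by rewrite ler_pM2r ?expR_gt0 // ler_pM2l ?expR_gt0.
rewrite -!expRD ler_expR.
have c2 : 0 < 16 * c ^+ 2 by rewrite mulr_gt0 // exprn_gt0.
have -> : - (eta th j ^+ 2 * n%:R / (16 * c ^+ 2)) =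
   eta th j ^+ 2 * n%:R / (16 * c ^+ 2) - eta th j ^+ 2 * n%:R / (8 * c ^+ 2).
  by field; rewrite ?lt0r_neq0 //.
rewrite lerD2r.
apply: (@le_trans _ _ (lam * j%:R * (2 * (mu th j * n%:R)) + mu th j * n%:R)).
  by rewrite lerD2r ler_wpM2l // mulr_ge0.
have -> : lam * j%:R * (2 * (mu th j * n%:R)) + mu th j * n%:R =
    (2 * lam * j%:R + 1) * mu th j * n%:R by ring.
rewrite [leRHS]mulrAC ler_pM2r // ler_pdivlMr //.
(* The surplus factor [th ^+ (2 * j)] of the entropy rate over the square of the deviation is what
   absorbs the logarithm. *)
have -> : mu th j = eta th j ^+ 2 * th ^+ (2 * j).
  have q4 : 1 / 4 = (1 / 2) ^+ 2 :> R by field.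
  rewrite /mu /eta q4; move: (1 / 2) => z; rewrite [(_ ^+ j * _) ^+ 2]exprMn -!exprM -mulrA -exprD.
  by rewrite (mulnC j 2) -mulnDl.
apply: (@le_trans _ _ (eta th j ^+ 2 *
    (16 * c ^+ 2 * (2 * lam * j%:R + 1) * th ^+ (2 * j)))).
  by rewrite le_eqVlt; apply/orP; left; apply/eqP; ring.
by rewrite -[leRHS]mulr1 ler_pM2l ?exprn_gt0.
Qed.

(** The endpoint is Q m and the full time n = A Q m, so the slope is 1/A. The loss is controlled
    only at the lengths q m with Q <= q <= A Q. In [zeta], the first term is the error at these
    lengths and the second, 2 c m / n, that of rounding a length up to a multiple of m. *)
Lemma slope_comparison_env c (th : R) (j0 J A' Q m : nat) f (h : R -> R) (xi0 : R) :
  let A := A'.*2 in let n := (A * Q * m)%N in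
  let zeta := xi0 * (1 + c) + 2 * c / (A * Q)%:R in
  0 < c -> 0 < th < 1 -> (j0 <= J)%N -> (forall x, `|f x| <= c) ->
  (0 < A')%N -> (0 < Q)%N -> (0 < m)%N -> (32 <= A * Q)%N ->
  (1 / 2) ^+ j0 <= 2 * c ->
  0 <= ln (4 / th ^+ 4) ->
  (forall j, (j0 <= j)%N ->
    16 * c ^+ 2 * (2 * ln (4 / th ^+ 4) * j%:R + 1) * th ^+ (2 * j) <= 1) ->
  \sum_(j0 <= j < J) 8 * th ^+ j <= 1 / 32 ->
  mu th J <= 1 / 96 ->
  (forall x, 0 <= x <= 1 -> 0 <= h x <= c) ->
  (forall x y, 0 < x -> x <= y -> y <= 1 -> h x / x <= h y / y) ->
  0 < xi0 <= 1 / 4 ->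
  (forall q, (Q <= q <= A * Q)%N ->
    avg (q * m) (fun b => (xi0 < `|mloss c f (q * m) (Q * m) b / (q * m)%:R - h (Q%:R / q%:R)|)%R%:R)
      <= xi0) ->
  (forall j, (j0 <= j <= J)%N ->
     (size (good_sites c f ((1 / 2) ^+ j) n))%:R <= mu th j * n%:R) ->
  3 * zeta < eta th J -> h (1 / A%:R) + 2 * zeta <= (1 / 2) ^+ j0 / 32 ->
  4 * (J.+1%:R * (16 * c ^+ 2)) <= eta th J ^+ 2 * n%:R -> (512 <= n)%N ->
  31 / 32 * h (32 / 31 / A%:R) <= h (1 / A%:R) + eta th J + 3 * zeta.
Proof.
move=> A n zeta c0 th01 jJ fc A'0 Q0 m0 AQ hc lam0 Hj Htail Hmu h01 hmono /andP[xi00 xi04] Hgrid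
  Hcount Hz HV Hn n512.
have zE : zeta = xi0 * (1 + c) + 2 * c / (A * Q)%:R by [].
have nD : n = (A * Q * m)%N by []. have AD : A = A'.*2 by [].
clearbody zeta; clearbody n; clearbody A.
have nn0 : (0 < n)%N by rewrite (leq_trans _ n512).
have nR : 0 < n%:R :> R by rewrite ltr0n.
have A0 : (0 < A)%N by rewrite AD double_gt0.
have AR : 0 < A%:R :> R by rewrite ltr0n.
have QR : 0 < Q%:R :> R by rewrite ltr0n.
have mR : 0 < m%:R :> R by rewrite ltr0n.
have AQR : 0 < (A * Q)%:R :> R by rewrite ltr0n muln_gt0 A0.
have nE : n = (A' * Q * m).*2 by rewrite nD AD -!mul2n !mulnA.
have t0 : 0 < th by case/andP: th01.
have zeta0 : 0 < zeta.
  rewrite zE addr_gt0 //; first by rewrite mulr_gt0 // addr_gt0.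
  by rewrite divr_gt0 // mulr_gt0.
(* Deviation in frequency becomes a bound on the mean: on the exceptional strings, of frequency at
   most [xi0], the loss is still nonnegative and h is at most c. *)
have grid_mean q : (Q <= q <= A * Q)%N ->
    (q * m)%:R * h (Q%:R / q%:R) - n%:R * (xi0 * (1 + c)) <=
    avg (q * m) (mloss c f (q * m) (Q * m)).
  move=> qq; have := Hgrid q qq; case/andP: qq => q1 q2.
  have qR : 0 < q%:R :> R by rewrite ltr0n (leq_trans Q0).
  have qmR : 0 < (q * m)%:R :> R by rewrite natrM mulr_gt0.
  set g := fun b => _; set H := h _ => avgg.
  have /andP[H0 Hc] : 0 <= H <= c.
    apply: h01; rewrite divr_ge0 //= ler_pdivrMr // mul1r ler_nat //.
  have qn : (q * m)%:R <= n%:R :> R by rewrite nD ler_nat leq_mul2r q2 orbT.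
  apply: (@le_trans _ _ (avg (q * m) (fun b => (q * m)%:R * (H - xi0) - (q * m)%:R * c * g b))).
    rewrite avgB avg_cst avgZ.
    have : (q * m)%:R * c * avg (q * m) g <= (q * m)%:R * c * xi0.
      by rewrite ler_wpM2l // mulr_ge0 // ltW.
    have : (q * m)%:R * (xi0 * (1 + c)) <= n%:R * (xi0 * (1 + c)).
      by rewrite ler_wpM2r // mulr_ge0 // ?ltW // addr_gt0.
    lra.
  apply: le_avg => b sb; rewrite /g; case: ltP => /= [_|].
    apply: (@le_trans _ _ 0); last by apply: mloss_ge0 => //; rewrite leq_mul2r q1 orbT.
    have : (q * m)%:R * H <= (q * m)%:R * c by rewrite ler_wpM2l // ltW.
    have : 0 <= (q * m)%:R * xi0 by rewrite mulr_ge0 // ltW.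
    lra.
  rewrite -/H ler_norml => /andP[h1 _]; rewrite mulr0 subr0 mulrC -ler_pdivlMr //; lra.
have mean n' : (Q * m <= n' <= n)%N -> exists q, [/\ (Q <= q <= A * Q)%N,
    (q * m < n' + m)%N &
    (q * m)%:R * h (Q%:R / q%:R) - n%:R * zeta <= avg n' (mloss c f n' (Q * m))].
  (* [q * m] is [n'] rounded up to a multiple of [m]. Waiting at the endpoint compares the two
     means, at a price of at most 2 c m. *)
  move=> /andP[n1 n2]; pose q := ((n' + m.-1) %/ m)%N.
  have q3 : (n' <= q * m)%N.
    have := divn_eq (n' + m.-1) m; have := ltn_mod (n' + m.-1) m; rewrite m0 -/q.
    move: (_ %% m)%N (q * m)%N => x y; clear -m0; lia.
  have q4 : (q * m < n' + m)%N.
    have := leq_trunc_div (n' + m.-1) m; rewrite -/q.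
    move: (q * m)%N => y; clear -m0; lia.
  have qq : (Q <= q <= A * Q)%N.
    apply/andP; split; first by rewrite -(leq_pmul2r m0); exact: leq_trans q3.
    rewrite -ltnS -(ltn_pmul2r m0) mulSn; apply: (leq_trans q4); rewrite addnC leq_add2l -nD //.
exists q; split => //. 
  have gm := grid_mean q qq.
  have : avg (q * m) (mloss c f (q * m) (Q * m)) <= avg n' (mloss c f n' (Q * m)) + 2 * c * m%:R.
    rewrite -{1 2}(subnKC q3) avg_cat -[X in _ <= _ + X](avg_cst n') -avgD.
    apply: le_avg => b sb.
    rewrite -[leRHS](avg_cst (q * m - n')); apply: le_avg => b' sb'.
    apply: (le_trans (mloss_cat fc n1 sb sb')); rewrite lerD2l ler_wpM2l //.
      by rewrite mulr_ge0 // ltW.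
    by rewrite ler_nat leq_subLR ltnW.
  have : n%:R * zeta = n%:R * (xi0 * (1 + c)) + 2 * c * m%:R.
    rewrite zE mulrDr; congr (_ + _); rewrite nD natrM; field; rewrite ?lt0r_neq0 //.
  lra.
(* With the endpoint fixed, the loss over time q m is Q m times h(x)/x at the slope x = Q/q, and
   h(x)/x is nondecreasing. *)
have scale q (al : R) : (Q <= q <= A * Q)%N -> 0 < al -> al <= Q%:R / q%:R ->
    (Q * m)%:R * (h al / al) <= (q * m)%:R * h (Q%:R / q%:R).
  move=> /andP[q1 q2] al0 alq.
  have qR : 0 < q%:R :> R by rewrite ltr0n (leq_trans Q0).
  have := hmono _ _ al0 alq; rewrite ler_pdivrMr // mul1r ler_nat => /(_ q1) hm.
  have -> : (q * m)%:R * h (Q%:R / q%:R) = (Q * m)%:R * (h (Q%:R / q%:R) / (Q%:R / q%:R)).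
    by rewrite !natrM; field; rewrite ?lt0r_neq0 //.
  by rewrite ler_wpM2l.
have n512' : (256 <= A' * Q * m)%N by rewrite -leq_double -nE.
have := @slope_comparison R c th j0 J (A' * Q * m) (Q * m) f (n%:R * h (1 / A%:R))
   (n%:R * (31 / 32 * h (32 / 31 / A%:R))) (n%:R * zeta).
rewrite -nE => main.
suff : n%:R * (31 / 32 * h (32 / 31 / A%:R)) <=
    n%:R * h (1 / A%:R) + eta th J * n%:R + 3 * (n%:R * zeta).
  move=> H; rewrite -(ler_pM2l nR); lra.
apply: main => //.
- by rewrite nD -mulnA leq_pmull.
- move=> n' n'n; have [q [qq q4 av]] := mean n' n'n; apply: le_trans av.
  have /andP[q1 q2] := qq.
  have qR : 0 < q%:R :> R by rewrite ltr0n (leq_trans Q0).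
  rewrite lerD2r.
  apply: le_trans (scale q (1 / A%:R) qq _ _); first last.
  + by rewrite ler_pdivlMr // mulrAC ler_pdivrMr // mul1r -natrM ler_nat mulnC.
  + by rewrite divr_gt0.
  + by rewrite le_eqVlt; apply/orP; left; apply/eqP; rewrite nD !natrM; field; rewrite ?lt0r_neq0 //.
- move=> n' n'n n15; have [q [qq q4 av]] := mean n' n'n; apply: le_trans av.
  have /andP[q1 q2] := qq.
  have qR : 0 < q%:R :> R by rewrite ltr0n (leq_trans Q0).
  rewrite lerD2r.
  apply: le_trans (scale q (32 / 31 / A%:R) qq _ _); first last.
  + have q5 : (q * m)%:R <= n'%:R + m%:R :> R by rewrite -natrD ler_nat ltnW.
    have m32 : 32 * m%:R <= n%:R :> R by rewrite -natrM ler_nat nD leq_mul2r AQ orbT.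
    (* 15/16 n for the cut walk and n/32 for the rounding: the slope Q/q is then at least 32/31
       times 1/A. *)
    have q6 : (q * m)%:R <= 31 / 32 * n%:R :> R by lra.
    rewrite ler_pdivlMr // mulrAC ler_pdivrMr //.
    rewrite -(ler_pM2r mR); move: q6; rewrite nD !natrM; lra.
  + by rewrite !divr_gt0.
  + by rewrite le_eqVlt; apply/orP; left; apply/eqP; rewrite nD !natrM; field; rewrite ?lt0r_neq0 //.
- have := Hgrid (A * Q)%N; rewrite leqnn leq_pmull // -nD => /(_ isT) hg.
  apply: le_trans (le_trans hg xi04); apply: le_avg => b sb; rewrite ler_nat.
  case: ltP => //= lt; rewrite lt0b.
  have -> : Q%:R / (A * Q)%:R = 1 / A%:R :> R by rewrite natrM; field; rewrite ?lt0r_neq0 //.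
  apply: lt_le_trans (ler_norm _); rewrite ltrBrDr ltr_pdivlMr //.
  apply: le_lt_trans lt; rewrite mulrC mulrDr [leRHS]addrC lerD2r ler_pM2l //.
  rewrite zE; have : 0 <= xi0 * c by rewrite mulr_ge0 // ltW.
  have : 0 <= 2 * c / (A * Q)%:R by rewrite divr_ge0 // mulr_ge0 // ltW.
  lra.
- apply: (@le_trans _ _ (\sum_(j0 <= j < J.+1) 16 * c ^+ 2 / (eta th J ^+ 2 * n%:R))).
    rewrite !big_seq; apply: ler_sum => j; rewrite mem_index_iota ltnS => jj.
    apply: (@le_trans _ _ (16 * c ^+ 2 / (eta th j ^+ 2 * n%:R))).
      apply: avg_atypical_level => //; last by apply: Hj; case/andP: jj.
      by rewrite natrM ler_wpM2l //; exact: Hcount.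
    rewrite ler_pM2l ?mulr_gt0 ?exprn_gt0 // lef_pV2 ?posrE ?mulr_gt0 ?exprn_gt0 ?eta_gt0 //.
    have ej i : 0 <= eta th i by exact/ltW/eta_gt0.
    rewrite ler_pM2r //; apply: lerXn2r; rewrite ?nnegrE //.
    by apply: eta_le => //; case/andP: jj.
  rewrite sumr_const_nat -[_ *+ (_ - _)]mulr_natr mulrAC ler_pdivrMr; last by rewrite mulr_gt0 // exprn_gt0 // eta_gt0.
  have : 16 * c ^+ 2 * (J.+1 - j0)%:R <= 16 * c ^+ 2 * J.+1%:R.
    by apply: ler_wpM2l; [rewrite mulr_ge0 // sqr_ge0|rewrite ler_nat leq_subr].
  lra.
- by rewrite nE; exact: few_alternations.
- by rewrite mulr_gt0.
- move=> j jj; rewrite mulrCA mulrC ltr_pM2r //; apply: (lt_le_trans Hz).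
  by apply: eta_le => //; case/andP: jj.
- have : n%:R * (h (1 / A%:R) + 2 * zeta) <= n%:R * ((1 / 2) ^+ j0 / 32) by rewrite ler_pM2l.
  lra.
Qed.

End CoreEnv.

(** * Measurability and independence *)

Section MinAction.
Context {R : realType}.

Lemma has_lbound_action (b f : int -> R) n k :
  has_lbound [set action b f n g | g in [set g | lazy_walk n k g]].
Proof.
exists (- \sum_(1 <= i < n.+1) `|b i%:Z| * \sum_(x <- window n) `|f x|).
move=> _ [g gl <-]; rewrite -sumrN /action [leLHS]big_seq [leRHS]big_seq; apply: ler_sum => i.
rewrite mem_index_iota ltnS => /andP[i1 i2].
rewrite -[leRHS]opprK lerN2 -mulrN; apply: le_trans (ler_norm _) _.
rewrite normrM normrN; apply: ler_wpM2l => //.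
have gw : g i \in window n.
  have [ps _] := lwalk_seq gl; apply: mem_window.
  have := near1_range (x := g i) ps; rewrite size_mkseq subr0; apply.
  by case: i i1 i2 => // i _ i2; apply/mapP; exists i => //; rewrite mem_iota.
by rewrite (big_rem (g i) gw) lerDl; exact: sumr_ge0.
Qed.

Lemma min_action_lt (b f : int -> R) n k z : (k <= n)%N ->
  min_action b f n k%:Z < z <->
  exists s : seq int, [/\ size s = n, path near1 0 s, last 0 s = k%:Z &
    action b f n (fun i => nth 0 (0 :: s) i) < z].
Proof.
move=> kn; split; last first.
  move=> [s [ss ps ls]]; apply: le_lt_trans; apply: ge_inf; first exact: has_lbound_action.
  exists (fun i => nth 0 (0 :: s) i) => //=; rewrite -ss; exact: seq_lwalk.
pose A := [set action b f n g | g in [set g | lazy_walk n k%:Z g]].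
have iA : has_inf A.
  split; last exact: has_lbound_action.
  by have [g gl] := lazy_walk_ex kn; exists (action b f n g), g.
rewrite -subr_gt0 => z0; have [_ [g gl <-]] := inf_adherent z0 iA.
rewrite addrC subrK => lt.
have [ps ls] := lwalk_seq gl.
exists (mkseq (fun i => g i.+1) n); rewrite size_mkseq; split => //.
apply: le_lt_trans lt; rewrite le_eqVlt; apply/orP; left; apply/eqP.
rewrite /action !big_add1 /= !big_mkord; apply: eq_bigr => i _.
by rewrite nth_mkseq.
Qed.

(** A strict sublevel set is a countable union over lists of positions. The measurable space is
    arbitrary so that the lemma also applies to the sigma-algebra generated by [F] alone. *)
Lemma measurable_min_action d (T : measurableType d) (bb ff : int -> T -> R) n k :
  (k <= n)%N ->
  (forall i, measurable_fun setT (bb i)) -> (forall x, measurable_fun setT (ff x)) ->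
  measurable_fun setT (fun w => min_action (bb^~ w) (ff^~ w) n k%:Z).
Proof.
move=> kn mb mf _; apply: (measurability _ (RGenInftyO.measurableE R)) => //.
move=> _ [_ [z ->] <-]; rewrite setTI.
pose S := [set s : seq int | [/\ size s = n, path near1 0 s & last 0 s = k%:Z]].
pose E (s : seq int) := [set w | S s /\
   action (bb^~ w) (ff^~ w) n (fun i => nth 0 (0 :: s) i) < z].
rewrite (_ : _ @^-1` _ = \bigcup_s E s); last first.
  apply/seteqP; split => w; rewrite /= in_itv /=.
    by move/(min_action_lt _ _ _ kn) => [s [? ? ? ?]]; exists s.
  move=> [s _ [[? ? ?] ?]]; apply/min_action_lt => //; by exists s.
apply: countable_bigcupT_measurable => [|s].
  exact: countableP.
have [Ss|nS] := pselect (S s); last first.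
  by rewrite (_ : E s = set0) //; apply/seteqP; split => w // -[].
rewrite (_ : E s = (fun w => action (bb^~ w) (ff^~ w) n (fun i => nth 0 (0 :: s) i)) @^-1` `]-oo, z[).
  rewrite -[X in measurable X]setTI.
  have ma : measurable_fun setT (fun w => action (bb^~ w) (ff^~ w) n (fun i => nth 0 (0 :: s) i)).
    by apply: measurable_sum => i; apply: measurable_funM.
  exact: ma.
by apply/seteqP; split => w /=; rewrite in_itv /= /E /=; [case|].
Qed.

End MinAction.

Section Independence.
Context {R : realType} {d : measure_display} {T : measurableType d} (P : probability T R).
Variables (F B : int -> T -> R).
Hypothesis mF : forall x, measurable_fun setT (F x).
Hypothesis mB : forall i, measurable_fun setT (B i).
Hypothesis ind : mutually_independent P (FB_family F B).
Hypothesis PB1 : forall i, P (B i @^-1` [set 1]) = (1 / 2)%:E.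
Hypothesis PBN : forall i, P (B i @^-1` [set -1]) = (1 / 2)%:E.

(** The pi-system of cylinders that generates the sigma-algebra of the environment. *)
Definition Fcyl : set (set T) := [set A | exists (s : seq int) (X : int -> set R),
  (forall x, measurable (X x)) /\ A = \bigcap_(x in [set x | x \in s]) (F x @^-1` X x)].

Lemma Fcyl_setI : setI_closed Fcyl.
Proof.
move=> _ _ [s [X [mX ->]]] [s' [X' [mX' ->]]].
pose Y (t : seq int) (Z : int -> set R) x := if x \in t then Z x else setT.
exists (s ++ s'), (fun x => Y s X x `&` Y s' X' x); split.
  by move=> x; apply: measurableI; rewrite /Y; case: ifP.
apply/seteqP; split => w /=.
  move=> [h1 h2] x _ /=; rewrite /Y; split; case: ifP => // xs; [exact: h1|exact: h2].
move=> h; split=> x /= xs.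
  by have := h x; rewrite /= mem_cat xs /= /Y xs => -[].
by have := h x; rewrite /= mem_cat xs orbT /= /Y xs => -[].
Qed.

Lemma measurable_Fpre x (X : set R) : measurable X -> measurable (F x @^-1` X).
Proof. by move=> mX; rewrite -[X in measurable X]setTI; exact: mF. Qed.

Lemma measurable_Bpre x (X : set R) : measurable X -> measurable (B x @^-1` X).
Proof. by move=> mX; rewrite -[X in measurable X]setTI; exact: mB. Qed.

Lemma measurable_cyl A : Fcyl A -> measurable A.
Proof.
move=> [s [X [mX ->]]]; apply: fin_bigcap_measurable; first exact: finite_seq.
by move=> x _; exact: measurable_Fpre.
Qed.

Definition Bevent (b : seq bool) : set T :=
  [set w | forall i, (i < size b)%N -> B i.+1%:Z w = sgn (nth true b i)].

Lemma BeventE b : Bevent b =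
  \bigcap_(i in [set i | i \in iota 0 (size b)]) (B i.+1%:Z @^-1` [set sgn (nth true b i)]).
Proof.
by apply/seteqP; split => w h i /=; have := h i; rewrite /= mem_iota add0n.
Qed.

Lemma measurable_Bevent b : measurable (Bevent b).
Proof.
rewrite BeventE; apply: fin_bigcap_measurable; first exact: finite_seq.
by move=> i _; exact: measurable_Bpre.
Qed.

Lemma Bevent_cyl b A : Fcyl A -> P (A `&` Bevent b) = ((2^-1 ^+ size b)%R%:E * P A)%E.
Proof.
(* Independence is stated for duplicate-free lists of indices. *)
move=> [s0 [X [mX ->]]]; pose s := undup s0.
pose XX (j : (int + int)%type) : set R :=
  match j with inl x => X x | inr i => [set sgn (nth true b `|i|%N.-1)] end.
pose tF : seq (int + int)%type := map inl s.
pose tB : seq (int + int)%type := map (fun i => inr i.+1%:Z) (iota 0 (size b)).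
have mXX j : measurable (XX j) by case: j => [x|i] //=.
have EF : \bigcap_(x in [set x | x \in s0]) (F x @^-1` X x) =
    \bigcap_(j in [set j | j \in tF]) (FB_family F B j @^-1` XX j).
  apply/seteqP; split => w h j /=.
    by move=> /mapP[x]; rewrite mem_undup => xs ->; exact: h.
  by move=> js; apply: (h (inl j)); apply/mapP; exists j; rewrite ?mem_undup.
have uF : uniq tF by rewrite map_inj_uniq ?undup_uniq // => x y [].
have uB : uniq tB by rewrite map_inj_uniq ?iota_uniq // => x y [].
have EA : \bigcap_(x in [set x | x \in s0]) (F x @^-1` X x) `&` Bevent b =
    \bigcap_(j in [set j | j \in tF ++ tB]) (FB_family F B j @^-1` XX j).
  rewrite EF BeventE; apply/seteqP; split => w.
    move=> [h1 h2] j /=; rewrite mem_cat => /orP[|/mapP[i ib ->]]; first exact: h1.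
    exact: (h2 i).
  move=> h; split=> [j /= jF|i /= ib]; first by apply: h; rewrite /= mem_cat jF.
  by apply: (h (inr i.+1%:Z)); rewrite /= mem_cat; apply/orP; right; apply: map_f.
have uFB : uniq (tF ++ tB).
  by rewrite cat_uniq uF uB andbT /=; apply/hasPn => _ /mapP[i _ ->]; apply/negP => /mapP[].
rewrite EA EF !ind // big_cat /= muleC; congr (_ * _)%E.
rewrite big_map /= (eq_bigr (fun=> (2^-1)%:E)); last first.
  by move=> i _; rewrite -[2^-1]div1r /sgn; case: (nth _ _ _); rewrite ?PB1 ?PBN.
by rewrite prodEFin big_const_seq count_predT size_iota iter_mulr_1.
Qed.

Lemma Bevent_Fsigma b A : <<s Fcyl >> A ->
  P (A `&` Bevent b) = ((2^-1 ^+ size b)%R%:E * P A)%E.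
Proof.
have sub : <<s Fcyl >> `<=` [set A | measurable A /\
    P (A `&` Bevent b) = ((2^-1 ^+ size b)%R%:E * P A)%E]; last by move=> /sub[].
have mb := measurable_Bevent b.
apply: lambda_system_subset; [exact: Fcyl_setI| | |by []]; last first.
  by move=> X FX; split; [exact: measurable_cyl|exact: Bevent_cyl].
have PT : P (Bevent b) = (2^-1 ^+ size b)%R%:E.
  have := @Bevent_cyl b setT; rewrite setTI probability_setT mule1; apply.
  exists [::], (fun=> setT); split => //.
  by apply/seteqP; split => w.
apply/dynkin_lambda_system; split => /=.
- by split => //; rewrite setTI probability_setT mule1.
- move=> X [mX PX]; split; first exact: measurableC.
  have -> : ~` X `&` Bevent b = Bevent b `\` X by rewrite setDE setIC.
  rewrite measureD ?probability_setC //; last first.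
    exact: le_lt_trans (probability_le1 _ _) (ltry _).
  transitivity ((2^-1 ^+ size b)%R%:E - (2^-1 ^+ size b)%R%:E * P X)%E.
    by congr (_ - _)%E; [exact: PT|rewrite setIC; exact: PX].
  have /fineK <- : P X \is a fin_num by exact: fin_num_measure.
  by rewrite -EFinM -!EFinB -EFinM mulrBr mulr1.
- move=> X tX H; split; first by apply: bigcup_measurable => k _; exact: (H k).1.
  rewrite setI_bigcupl !measure_bigcup //; last 3 first.
  + by move=> k _; exact: (H k).1.
  + by move=> k _; apply: measurableI => //; exact: (H k).1.
  + by apply: trivIset_setIr.
  rewrite -nneseriesZl //.
  by apply: eq_eseriesr => k _; exact: (H k).2.
Qed.

End Independence.

(** * First-moment selection and transfer to frozen environments *)

Section Prob.
Context {R : realType} {d : measure_display} {T : measurableType d} (P : probability T R).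

Lemma sum_disjoint_le (I : eqType) (r : seq I) (C : I -> set T) (D : set T) :
  uniq r -> measurable D -> (forall i, measurable (C i)) ->
  (forall i, i \in r -> C i `<=` D) ->
  (forall i j, i \in r -> j \in r -> i != j -> C i `&` C j = set0) ->
  (\sum_(i <- r) P (C i) <= P D)%E.
Proof.
elim: r D => [|i r IH] D /=; first by rewrite big_nil measure_ge0.
move=> /andP[ir ur] mD mC CD dis; rewrite big_cons.
have -> : P D = (P (C i) + P (D `\` C i))%E.
  rewrite (measureDI P mD (mC i)) addeC; congr (P _ + _)%E.
  by apply: setIidr; apply: CD; rewrite inE eqxx.
apply: leeD => //; apply: IH => //; first exact: measurableD.
  move=> j jr w Cj; split; first by apply: CD Cj; rewrite inE jr orbT.
  move=> Ci; have : (C i `&` C j) w by [].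
  rewrite dis ?inE ?eqxx ?jr ?orbT //.
  by apply: contraNneq ir => ->.
by move=> j k jr kr; apply: dis; rewrite inE ?jr ?kr orbT.
Qed.

(** First-moment method: a weighted count of bad events with mean below 1 is below 1 at some point
    of the almost sure set. The weights are reciprocals of tolerances, so that each tolerance is
    then met separately. *)
Lemma markov_select (I : eqType) (r : seq I) (a : I -> R) (E : I -> set T) (O : set T) :
  (forall i, 0 <= a i) -> (forall i, measurable (E i)) -> {ae P, forall w, O w} ->
  (\sum_(i <- r) (a i)%:E * P (E i) < 1)%E ->
  exists w, O w /\ \sum_(i <- r) a i * \1_(E i) w < 1.
Proof.
move=> a0 mE aeO lt; apply: contrapT => H.
have : (1 <= \sum_(i <- r) (a i)%:E * P (E i))%E; last by rewrite leNgt lt.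
have -> : (\sum_(i <- r) (a i)%:E * P (E i) =
    \int[P]_w (\sum_(i <- r) (a i * \1_(E i) w)%:E))%E.
  rewrite ge0_integral_sum //.
  - apply: eq_bigr => i _; under eq_integral do rewrite EFinM.
    rewrite ge0_integralZl_EFin ?integral_indic ?setIT //.
    by apply/measurable_EFinP; exact: measurable_indic.
  - move=> i; apply/measurable_EFinP; apply: measurable_funM; first exact: measurable_cst.
    exact: measurable_indic.
  - by move=> i w _; rewrite lee_fin mulr_ge0.
apply: (@le_trans _ _ (\int[P]_w (cst 1 w))%E).
  by rewrite integral_cst // mul1e (_ : _ setT = 1%E) //; exact: probability_setT.
apply: ae_ge0_le_integral => //.
- by move=> w _; apply: sume_ge0 => i _; rewrite lee_fin mulr_ge0.
- apply: emeasurable_sum => i; apply/measurable_EFinP; apply: measurable_funM; first exact: measurable_cst.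
  exact: measurable_indic.
apply: filterS aeO => w Ow _; rewrite sumEFin lee_fin leNgt; apply/negP => lt1.
by apply: H; exists w.
Qed.

(** The tail unions [E n] decrease to a null set, so their probabilities tend to 0. *)
Lemma prob_cvg (X : nat -> T -> R) (l xi e : R) :
  (forall n, measurable_fun setT (X n)) -> {ae P, forall w, X^~ w @ \oo --> l} ->
  0 < xi -> 0 < e ->
  exists N, forall n, (N <= n)%N -> (P [set w | (xi < `|X n w - l|)%R] < e%:E)%E.
Proof.
move=> mX [C [mC C0 sC]] xi0 e0.
pose Bd n := [set w | (xi < `|X n w - l|)%R].
have mBd n : measurable (Bd n).
  have -> : Bd n = (fun w => `|X n w - l|) @^-1` `]xi, +oo[.
    by apply/seteqP; split => w /=; rewrite in_itv /= andbT.
  rewrite -[X in measurable X]setTI.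
  have : measurable_fun setT (fun w => `|X n w - l|).
    by apply: measurableT_comp => //; apply: measurable_funB.
  by apply => //; exact: measurable_itv.
pose E n := \bigcup_(i >= n) Bd i.
have mE n : measurable (E n) by apply: bigcup_measurable => i _.
have dE : nonincreasing_seq E.
  move=> n m nm; apply/asboolP => w [i /= mi Bi]; exists i => //=.
  exact: leq_trans mi.
have I0 : P (\bigcap_n E n) = 0.
  apply: (subset_measure0 _ mC _ C0) => //; first exact: bigcap_measurable.
  move=> w Ew; apply: sC => /= cv.
  have /cvgrPdist_lt/(_ _ xi0)[N _ HN] := cv.
  have [i /= Ni] := Ew N I; rewrite /Bd /= distrC ltNge => /negP; apply.
  exact/ltW/HN.
have : P \o E @ \oo --> P (\bigcap_n E n).
  apply: nonincreasing_cvg_mu => //; last exact: bigcap_measurable.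
  exact: le_lt_trans (probability_le1 _ _) (ltry _).
rewrite I0 => /fine_cvgP[_] /cvgr0_norm_lt/(_ e e0)[N _ HN].
exists N => n Nn; have := HN N (leqnn N) => /=.
rewrite ger0_norm ?fine_ge0 ?measure_ge0 // => lt.
have fE : P (E N) \is a fin_num by exact: fin_num_measure.
apply: (@le_lt_trans _ _ (P (E N))); last by rewrite -(fineK fE) lte_fin.
apply: le_measure; rewrite ?inE; [exact: mBd|exact: mE|].
by move=> w Bw; exists n.
Qed.

End Prob.

Lemma sgn_inj (R : realType) : injective (@sgn R).
Proof. by case; case=> //=; rewrite /sgn => e; exfalso; lra. Qed.

Section Bad.
Context {R : realType} {d : measure_display} {T : measurableType d} (P : probability T R).
Variables (F B : int -> T -> R).
Hypothesis mF : forall x, measurable_fun setT (F x).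
Hypothesis mB : forall i, measurable_fun setT (B i).
Hypothesis ind : mutually_independent P (FB_family F B).
Hypothesis PB1 : forall i, P (B i @^-1` [set 1]) = (1 / 2)%:E.
Hypothesis PBN : forall i, P (B i @^-1` [set -1]) = (1 / 2)%:E.

(** The signs are a parameter here, so that the event concerns [F] only and is independent of every
    [Bevent]. *)
Definition badF (c v xi : R) N k (b : seq bool) : set T :=
  [set w | (xi < `|mloss c (F^~ w) N k b / N%:R - v|)%R].

Lemma badF_gen (d' : measure_display) (T' : measurableType d') (F' : int -> T' -> R) c v xi N k b :
  (k <= N)%N -> (forall x, measurable_fun setT (F' x)) ->
  measurable [set w | (xi < `|mloss c (F'^~ w) N k b / N%:R - v|)%R].
Proof.
move=> kN mF'.
rewrite (_ : mkset _ = (fun w => `|mloss c (F'^~ w) N k b / N%:R - v|) @^-1` `]xi, +oo[); last first.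
  by apply/seteqP; split => w /=; rewrite in_itv /= andbT.
rewrite -[X in measurable X]setTI.
have mm : measurable_fun setT (fun w => `|mloss c (F'^~ w) N k b / N%:R - v|).
  apply: measurableT_comp => //; apply: measurable_funB => //; apply: measurable_funM => //.
  apply: measurable_funD => //.
  by apply: (@measurable_min_action R d' T' (fun i _ => sgn (nth true b `|i|%N.-1))).
by apply: mm => //; exact: measurable_itv.
Qed.

Lemma measurable_badF c v xi N k b : (k <= N)%N -> measurable (badF c v xi N k b).
Proof. by move=> kN; exact: badF_gen. Qed.

Lemma badF_sigma c v xi N k b : (k <= N)%N -> <<s Fcyl F >> (badF c v xi N k b).
Proof.
move=> kN; apply: (@badF_gen _ (g_sigma_algebraType (Fcyl F))) => // x _ Y mY.
rewrite setTI; apply: sub_sigma_algebra; exists [:: x], (fun=> Y); split => //.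
by apply/seteqP; split => w /=; [move=> h y; rewrite /= inE => /eqP ->|apply; rewrite /= inE].
Qed.

Lemma min_action_Bevent N k b w : size b = N -> Bevent B b w ->
  min_action (B^~ w) (F^~ w) N k =
  min_action (fun i => sgn (nth true b `|i|%N.-1)) (F^~ w) N k.
Proof.
move=> sb Bb; congr inf; apply/seteqP; split => _ [g gl <-]; exists g => //;
  rewrite /action !big_add1 /= !big_mkord; apply: eq_bigr => i _; congr (_ * _);
  by rewrite Bb ?sb.
Qed.

(** The Fubini step: on the disjoint events [Bevent B b], the true loss is the one for frozen signs
    [b], and independence gives each piece the factor 2^-N. *)
Lemma avg_badF c v xi N k : (k <= N)%N ->
  (\sum_(b <- bits N) ((2^-1 ^+ N)%R%:E * P (badF c v xi N k b)) <=
   P [set w | (xi < `|(c * N%:R + min_action (B^~ w) (F^~ w) N k%:Z) / N%:R - v|)%R])%E.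
Proof.
move=> kN.
have mD : measurable [set w | (xi < `|(c * N%:R + min_action (B^~ w) (F^~ w) N k%:Z) / N%:R - v|)%R].
  rewrite (_ : mkset _ = (fun w => `|(c * N%:R + min_action (B^~ w) (F^~ w) N k%:Z) / N%:R - v|) @^-1` `]xi, +oo[); last first.
    by apply/seteqP; split => w /=; rewrite in_itv /= andbT.
  rewrite -[X in measurable X]setTI.
  have mm : measurable_fun setT (fun w => `|(c * N%:R + min_action (B^~ w) (F^~ w) N k%:Z) / N%:R - v|).
    apply: measurableT_comp => //; apply: measurable_funB => //; apply: measurable_funM => //.
    by apply: measurable_funD => //; exact: measurable_min_action.
  by apply: mm => //; exact: measurable_itv.
have -> : (\sum_(b <- bits N) ((2^-1 ^+ N)%R%:E * P (badF c v xi N k b)) =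
    \sum_(b <- bits N) P (badF c v xi N k b `&` Bevent B b))%E.
  rewrite [LHS]big_seq [RHS]big_seq; apply: eq_bigr => b; rewrite mem_bits => /eqP sb.
  rewrite -{1}sb (Bevent_Fsigma mF mB ind PB1 PBN) //; exact: badF_sigma.
apply: sum_disjoint_le => //.
- elim: N {kN mD} => //= N IH; rewrite cat_uniq !map_inj_uniq ?IH ?andbT //=; try by move=> ? ? [].
  by apply/hasPn => _ /mapP[y _ ->]; apply/negP => /mapP[].
- by move=> b; apply: measurableI; [exact: measurable_badF|exact: measurable_Bevent].
- move=> b; rewrite mem_bits => /eqP sb w [/= bad Bb].
  by rewrite (min_action_Bevent _ sb Bb).
move=> b b'; rewrite !mem_bits => /eqP sb /eqP sb' bb'.
apply/seteqP; split => // w [[_ h] [_ h']]; move/negP: bb'; apply; apply/eqP.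
apply: (@eq_from_nth _ true); rewrite ?sb ?sb' // => i iN.
have e1 := h i; rewrite sb iN in e1; have e2 := h' i; rewrite sb' iN (e1 isT) in e2.
move: (e2 isT).
exact: sgn_inj.
Qed.

End Bad.

(** * Tails of the spatial potential *)

Section Density.
Context {R : realType} (c q kappa : R) (rho : R -> R).
Hypothesis c0 : 0 < c.
Hypothesis q0 : 0 < q.
Hypothesis k0 : 0 < kappa.
Hypothesis rhoN : forall x, rho (- x) = rho x.
Hypothesis rho_cont : {in `]-c, c[, continuous rho}.
Hypothesis rho_gt0 : forall x, - c < x < c -> 0 < rho x.
Hypothesis rho_out : forall x, ~ (- c < x < c) -> rho x = 0.
Hypothesis rho_lim : (fun x => rho x / (c - x) `^ kappa) @ at_left c --> q.

Lemma rho_ge0 x : 0 <= rho x.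
Proof.
have [/rho_gt0/ltW//|/negP h] := boolP (- c < x < c).
by rewrite rho_out.
Qed.

(** Within [h] of the edge the density is at most 2 q (c - y)^kappa, and this is at most 2 q h^kappa
    because kappa is positive. *)
Lemma rho_edge : exists2 e : R, 0 < e < c & forall h y, 0 < h <= e -> c - h < y ->
  rho y <= 2 * q * h `^ kappa * \1_(`]c - h, c[%classic : set R) y.
Proof.
have c0' := c0; have k0' := ltW k0; have q0' := q0.
have /cvgrPdist_lt/(_ _ q0) := rho_lim.
move=> [e /= e0 H].
have m0 : 0 < Num.min e (c / 2) by rewrite lt_min e0 divr_gt0.
exists (Num.min e (c / 2)).
  by rewrite m0 /= gt_min; apply/orP; right; rewrite ltr_pdivrMr // ltr_pMr // ltr1n.
move=> h y /andP[h0]; rewrite le_min => /andP[he hc] yh.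
have [yc|yc] := ltP y c; last first.
  rewrite rho_out; last by move=> /andP[_]; lra.
  by rewrite !mulr_ge0 ?powR_ge0 // ltW.
rewrite indicE mem_set ?mulr1; last by rewrite /= in_itv /= yh yc.
have cy : 0 < c - y by lra.
have /= := H y; rewrite /ball /= ger0_norm; last lra.
move=> /(_ _ yc); have cyh : c - y < h by lra.
rewrite distrC => /(_ (lt_le_trans cyh he)) /(le_lt_trans (ler_norm _)) lt.
have p0 : 0 < (c - y) `^ kappa by exact: powR_gt0.
have lt2 : rho y <= 2 * q * (c - y) `^ kappa.
  by rewrite -ler_pdivrMr //; lra.
apply: (le_trans lt2); rewrite ler_pM2l ?mulr_gt0 //.
by apply: ge0_ler_powR => //; rewrite ?nnegrE; lra.
Qed.

Lemma measurable_rho : measurable_fun setT rho.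
Proof.
have -> : rho = rho \_ `]-c, c[%classic.
  apply/funext => x; rewrite /patch; case: ifPn => // /negP nx; rewrite rho_out // => h.
  by apply: nx; rewrite inE /= in_itv.
apply/(measurable_restrictT _ _).1; first exact: measurable_itv.
apply: open_continuous_measurable_fun; first exact: interval_open.
by move=> x; rewrite inE /=; exact: rho_cont.
Qed.

Context {d : measure_display} {T : measurableType d} (P : probability T R).
Variables (F B : int -> T -> R).
Hypothesis mF : forall x, measurable_fun setT (F x).
Hypothesis mB : forall i, measurable_fun setT (B i).
Hypothesis ind : mutually_independent P (FB_family F B).
Hypothesis PB1 : forall i, P (B i @^-1` [set 1]) = (1 / 2)%:E.
Hypothesis PBN : forall i, P (B i @^-1` [set -1]) = (1 / 2)%:E.
Hypothesis PF : forall x (A : set R), measurable A ->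
     P (F x @^-1` A) = (\int[lebesgue_measure]_(y in A) (rho y)%:E)%E.

Lemma integral_edge (A J : set R) (a h : R) : measurable A -> measurable J -> 0 <= a ->
  lebesgue_measure J = h%:E ->
  (forall y, A y -> rho y <= a * \1_J y) ->
  (\int[lebesgue_measure]_(y in A) (rho y)%:E <= (a * h)%:E)%E.
Proof.
move=> mA mJ a0 mJh H.
apply: (@le_trans _ _ (\int[lebesgue_measure]_(y in A) (a * \1_J y)%:E)%E).
  apply: ge0_le_integral => //.
  - by move=> y _; rewrite lee_fin rho_ge0.
  - by apply/measurable_EFinP; exact: measurable_funS measurable_rho.
  - apply/measurable_EFinP; apply: measurable_funM => //; exact: measurable_indic.
under eq_integral do rewrite EFinM.
rewrite ge0_integralZl_EFin ?integral_indic //; last first.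
  by apply/measurable_EFinP; exact: measurable_indic.
rewrite EFinM; apply: lee_wpmul2l; first by rewrite lee_fin.
by rewrite -mJh; apply: le_measure; rewrite ?inE //; exact: measurableI.
Qed.

Lemma tail_edge : exists2 e : R, 0 < e < c & forall h x, 0 < h <= e ->
  let Up : set R := `]c - h, +oo[%classic in
  let Dn : set R := `]-oo, - c + h[%classic in
  let p := 2 * q * h `^ kappa * h in
  (P (F x @^-1` Up) <= p%:E)%E /\ (P (F x @^-1` Dn) <= p%:E)%E.
Proof.
have [e ec H] := rho_edge; exists e => // h x he Up Dn p; have /andP[h0 he'] := he.
have a0 : 0 <= 2 * q * h `^ kappa by rewrite !mulr_ge0 ?powR_ge0 // ltW.
have mU : measurable Up by exact: measurable_itv.
have mD : measurable Dn by exact: measurable_itv.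
split; rewrite PF //.
- apply: (@integral_edge _ `]c - h, c[%classic) => //.
    by rewrite lebesgue_measure_itv /= lte_fin ltrBlDr ltrDl h0 -EFinB; congr EFin; ring.
  by move=> y; rewrite /Up /= in_itv /= andbT; exact: H.
- apply: (@integral_edge _ `]- c, - c + h[%classic) => //.
    by rewrite lebesgue_measure_itv /= lte_fin ltrDl h0 -EFinB; congr EFin; ring.
  move=> y; rewrite /Dn /= in_itv /= => yh.
  have yN : c - h < - y by lra.
  rewrite -rhoN; apply: (le_trans (H h (- y) he yN)).
  rewrite ler_wpM2l // !indicE ler_nat.
  have -> : (- y \in (`]c - h, c[%classic : set R)) = (y \in (`]- c, - c + h[%classic : set R)).
    by apply/idP/idP; rewrite !inE /= !in_itv /= => /andP[? ?]; apply/andP; split; lra.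
  by [].
Qed.


Lemma ind2 x y (X Y : set R) : x != y -> measurable X -> measurable Y ->
  P (F x @^-1` X `&` F y @^-1` Y) = (P (F x @^-1` X) * P (F y @^-1` Y))%E.
Proof.
move=> xy mX mY.
pose A (j : (int + int)%type) := if j == inl x then X else Y.
have mA j : measurable (A j) by rewrite /A; case: ifP.
have u : uniq [:: inl x; inl y : (int + int)%type] by rewrite /= inE andbT.
have := ind u (fun j _ => mA j).
have Ax : A (inl x) = X by rewrite /A eqxx.
have Ay : A (inl y) = Y by rewrite /A (inj_eq (@inl_inj _ _)) eq_sym (negbTE xy).
rewrite big_cons big_seq1 /= Ax Ay => <-; congr (P _).
apply/seteqP; split => w /=.
  by move=> [hx hy] j; rewrite /= !inE => /orP[] /eqP ->; rewrite /= ?Ax ?Ay.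
move=> h; split.
  by have := h (inl x); rewrite /= inE eqxx /= Ax; apply.
by have := h (inl y); rewrite /= !inE eqxx orbT /= Ay; apply.
Qed.

Definition edge_pair (h : R) (x : int) : set T :=
  (F x @^-1` `]c - h, +oo[%classic `&` F (x + 1) @^-1` `]-oo, - c + h[%classic) `|`
  (F x @^-1` `]-oo, - c + h[%classic `&` F (x + 1) @^-1` `]c - h, +oo[%classic).

Lemma measurable_edge_pair h x : measurable (edge_pair h x).
Proof.
by apply: measurableU; apply: measurableI; apply: (measurable_Fpre mF);
  exact: measurable_itv.
Qed.

(** Both values lie in [-c, c], so a difference above 2 c - h puts them within [h] of opposite
    ends. *)
Lemma gap_edge_pair h x w : (forall x, `|F x w| <= c) ->
  gap c (F^~ w) x < h -> edge_pair h x w.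
Proof.
move=> Fc; have := Fc x; have := Fc (x + 1).
rewrite /gap !ler_norml => /andP[? ?] /andP[? ?] lt.
rewrite /edge_pair /= !in_itv /= !andbT.
have [p|p] := leP 0 (F x w - F (x + 1) w).
  by move: lt; rewrite ger0_norm // => lt; left; split; lra.
by move: lt; rewrite ltr0_norm // => lt; right; split; lra.
Qed.

(** Independence of the two ends squares the tail bound, and there are two orientations; the order
    is h^(2 (kappa + 1)). *)
Lemma edge_pair_prob : exists2 e : R, 0 < e & forall h x, 0 < h <= e ->
  (P (edge_pair h x) <= (2 * (2 * q * h `^ kappa * h) ^+ 2)%:E)%E.
Proof.
have [e /andP[e0 ec] H] := tail_edge; exists e => // h x he.
set p := 2 * q * h `^ kappa * h.
have x1 : x != x + 1 by rewrite -subr_eq0 opprD addrA subrr add0r.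
have [u1 d1] := H h x he; have [u2 d2] := H h (x + 1) he.
apply: (le_trans (measureU2 _ _ _)).
- by apply: measurableI; apply: (measurable_Fpre mF); exact: measurable_itv.
- by apply: measurableI; apply: (measurable_Fpre mF); exact: measurable_itv.
have i2 (X Y : set R) : measurable X -> measurable Y ->
    (P (F x @^-1` X) <= p%:E)%E -> (P (F (x + 1)%R @^-1` Y) <= p%:E)%E ->
    (P (F x @^-1` X `&` F (x + 1)%R @^-1` Y) <= (p * p)%:E)%E.
  by move=> mX mY pX pY; rewrite ind2 // EFinM; apply: lee_pmul.
rewrite expr2 mulr2n mulrDl mul1r EFinD.
by apply: leeD; apply: i2.
Qed.

Lemma ae_F_le : {ae P, forall w, forall x, `|F x w| <= c}.
Proof.
have out x : {ae P, forall w, `|F x w| <= c}.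
  exists (F x @^-1` (~` `[- c, c]%classic)); split.
  - by apply: (measurable_Fpre mF); apply: measurableC; exact: measurable_itv.
  - rewrite PF; last by apply: measurableC; exact: measurable_itv.
    apply: integral0_eq => y ny; rewrite rho_out // => /andP[y1 y2]; apply: ny.
    by rewrite /= in_itv /= !ltW.
  - by move=> w /= h; rewrite in_itv /= => h'; apply: h; rewrite ler_norml.
have H : {ae P, forall w, forall n : nat, `|F n%:Z w| <= c /\ `|F (- n%:Z) w| <= c}.
  by apply: ae_foralln => n; apply: filterS2 (out n%:Z) (out (- n%:Z)) => w.
apply: filterS H => w h [n|n]; first by case: (h n).
by rewrite NegzE; case: (h n.+1).
Qed.

Lemma ae_B_sign : {ae P, forall w, forall n : nat, B n%:Z w = 1 \/ B n%:Z w = -1}.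
Proof.
apply: ae_foralln => n.
pose A := B n%:Z @^-1` [set 1] `|` B n%:Z @^-1` [set -1].
have mA : measurable A by apply: measurableU; exact: (measurable_Bpre mB).
have PA : P A = 1%E.
  transitivity (P (B n%:Z @^-1` [set 1%R]) + P (B n%:Z @^-1` [set (-1)%R]))%E; last first.
    by rewrite PB1 PBN -EFinD; congr EFin; lra.
  apply: measureU; [exact: (measurable_Bpre mB)|exact: (measurable_Bpre mB)|].
  by apply/seteqP; split => w //= [-> /eqP]; rewrite -subr_eq0 opprK => /eqP; lra.
exists (~` A); split; first exact: measurableC.
- transitivity (1 - P A)%E; first exact: probability_setC.
  by rewrite PA subee.
- by move=> w /= h [h1|h1]; apply: h; [left|right].
Qed.

Lemma tail_gt0 x h : 0 < h < c ->
  let Up : set R := `]c - h, +oo[%classic in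
  let Dn : set R := `]-oo, - c + h[%classic in
  (0 < P (F x @^-1` Up))%E /\ (0 < P (F x @^-1` Dn))%E.
Proof.
move=> /andP[h0 hc] Up Dn.
have key (a b : R) (A : set R) : a < b -> - c <= a -> b <= c -> measurable A ->
    `]a, b[%classic%R `<=` A -> (0 < \int[lebesgue_measure]_(y in A) (rho y)%:E)%E.
  move=> ab ca bc mA sub; rewrite lt_neqAle; apply/andP; split; last first.
    by apply: integral_ge0 => y _; rewrite lee_fin rho_ge0.
  apply/eqP => e0.
  have mr : measurable_fun A (fun y => (rho y)%:E).
    by apply/measurable_EFinP; exact: measurable_funS measurable_rho.
  have : (\int[lebesgue_measure]_(y in A) `|(rho y)%:E| = 0)%E.
    rewrite [RHS]e0; apply: eq_integral => y _; rewrite gee0_abs // lee_fin.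
    exact: rho_ge0.
  move/(ae_eq_integral_abs lebesgue_measure mA mr) => [N [mN N0 sN]].
  have : (lebesgue_measure (`]a, b[%classic : set R) <= lebesgue_measure N)%E.
    apply: le_measure; rewrite ?inE //.
    move=> y yab; apply: sN => /= hy; have := hy (sub _ yab) => -[] /eqP.
    rewrite gt_eqF // rho_gt0 //; move: yab; rewrite /= in_itv /= => /andP[? ?].
    by apply/andP; split; lra.
  rewrite N0 lebesgue_measure_itv /= lte_fin ab -EFinB lee_fin; lra.
split; rewrite PF; try exact: measurable_itv.
- apply: (key (c - h) c); try lra; first exact: measurable_itv.
  by move=> y; rewrite /Up /= !in_itv /= andbT => /andP[].
- apply: (key (- c) (- c + h)); try lra; first exact: measurable_itv.
  by move=> y; rewrite /Dn /= !in_itv /= => /andP[].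
Qed.

End Density.

(** * The value at zero slope *)

Lemma round0_nat (R : realType) (k : nat) : round0 (k%:R : R) = k%:Z.
Proof. rewrite /round0 ler0n; exact: (@intrKfloor R k%:Z). Qed.

Lemma small_pow (R : realType) (th e : R) : 0 < th < 1 -> 0 < e ->
  exists N, forall j, (N <= j)%N -> th ^+ j <= e.
Proof.
move=> /andP[t0 t1] e0.
have /cvg_expr/cvgr0_norm_lt/(_ e e0)[N _ H] : `|th| < 1 by rewrite ger0_norm // ltW.
exists N => j Nj; apply: le_trans (ler_norm _) _; exact/ltW/H.
Qed.

Lemma geom_tail (R : realType) (th : R) i j : 0 < th < 1 ->
  \sum_(i <= k < j) th ^+ k <= th ^+ i / (1 - th).
Proof.
move=> /andP[t0 t1]; rewrite ler_pdivlMr ?subr_gt0 // mulr_suml.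
have [ij|ji] := leqP i j; last by rewrite big_geq ?exprn_ge0 ?ltW // ltnW.
rewrite (eq_bigr (fun k => - (th ^+ k.+1 - th ^+ k))); last by move=> k _; rewrite exprS; ring.
by rewrite sumrN telescope_sumr // opprB lerBlDr lerDl exprn_ge0 // ltW.
Qed.

(** This is y exp (- y) <= 1 at y = - j ln th; it absorbs the factor j in the entropy. *)
Lemma linear_pow (R : realType) (th : R) j : 0 < th < 1 ->
  - ln th * j%:R * th ^+ j <= 1.
Proof.
move=> /andP[t0 t1].
have -> : th ^+ j = (expR (- ln th * j%:R))^-1.
  by rewrite -expRN mulNr opprK expRM_natr lnK ?posrE.
rewrite ler_pdivrMr ?expR_gt0 // mul1r.
by apply: le_trans (expR_ge1Dx _); rewrite lerDr.
Qed.

Section Zero.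
Context {R : realType} (c q kappa : R) (rho : R -> R).
Hypothesis c0 : 0 < c.
Hypothesis q0 : 0 < q.
Hypothesis k0 : 0 < kappa.
Hypothesis rhoN : forall x, rho (- x) = rho x.
Hypothesis rho_cont : {in `]-c, c[, continuous rho}.
Hypothesis rho_gt0 : forall x, - c < x < c -> 0 < rho x.
Hypothesis rho_out : forall x, ~ (- c < x < c) -> rho x = 0.
Hypothesis rho_lim : (fun x => rho x / (c - x) `^ kappa) @ at_left c --> q.
Context {d : measure_display} {T : measurableType d} (P : probability T R).
Variables (F B : int -> T -> R).
Hypothesis mF : forall x, measurable_fun setT (F x).
Hypothesis mB : forall i, measurable_fun setT (B i).
Hypothesis ind : mutually_independent P (FB_family F B).
Hypothesis PB1 : forall i, P (B i @^-1` [set 1]) = (1 / 2)%:E.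
Hypothesis PBN : forall i, P (B i @^-1` [set -1]) = (1 / 2)%:E.
Hypothesis PF : forall x (A : set R), measurable A ->
     P (F x @^-1` A) = (\int[lebesgue_measure]_(y in A) (rho y)%:E)%E.
Variable Lambda : R -> R.
Hypothesis shape : {ae P, forall w, forall a, -1 <= a <= 1 ->
     (fun n : nat => min_action (fun i => B i w) (fun x => F x w) n (round0 (a * n%:R)) / n%:R)
       @ \oo --> - Lambda a}.

(** Every step costs at least -c, hence the upper bound. For the lower one, the limit is
    deterministic, so a positive-probability event suffices: F nearly c at 0 and nearly -c at 1. The
    walk then chooses between these two sites according to the sign. *)
Lemma Lambda0 : Lambda 0 = c.
Proof.
have ae3 : {ae P, forall w, [/\ forall a, -1 <= a <= 1 ->
     (fun n : nat => min_action (fun i => B i w) (fun x => F x w) n (round0 (a * n%:R)) / n%:R)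
       @ \oo --> - Lambda a, forall x, `|F x w| <= c &
       forall n : nat, B n%:Z w = 1 \/ B n%:Z w = -1]}.
  apply: filterS3 shape (ae_F_le rho_out mF PF) (ae_B_sign mB PB1 PBN) => w h1 h2 h3.
  by split.
have z1 : -1 <= (0 : R) <= 1 by lra.
have r0 n : round0 (0 * n%:R : R) = 0%N%:Z by rewrite mul0r -(round0_nat R 0).
have BF w n (g : nat -> int) i : (forall x, `|F x w| <= c) -> (forall n : nat, B n%:Z w = 1 \/ B n%:Z w = -1) ->
    - c <= B i%:Z w * F (g n) w <= c.
  move=> hF hB; have := hF (g n); rewrite ler_norml => /andP[? ?].
  by case: (hB i) => ->; lra.
apply/eqP; rewrite eq_le; apply/andP; split.
- have [w [[cv hF hB] _]] : exists w, [/\ forall a, -1 <= a <= 1 ->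
     (fun n : nat => min_action (fun i => B i w) (fun x => F x w) n (round0 (a * n%:R)) / n%:R)
       @ \oo --> - Lambda a, forall x, `|F x w| <= c &
       forall n : nat, B n%:Z w = 1 \/ B n%:Z w = -1] /\
       \sum_(i <- [::] : seq nat) (fun=> 0 : R) i * \1_((fun=> set0 : set T) i) w < 1.
    by apply: markov_select ae3 _ => //; rewrite big_nil.
  rewrite -lerN2; apply: (@ler_cvg_to nat \oo _ R (fun=> - c) _ _ _ (cvg_cst (- c)) (cv 0 z1)).
  exists 1%N => // n /= n1; rewrite ler_pdivlMr ?ltr0n // r0.
  have [g0 gl0] := @lazy_walk_ex n 0 isT.
  apply: lb_le_inf; first by exists (action (B^~ w) (F^~ w) n g0), g0.
  move=> _ [g gl <-]; rewrite /action big_add1 /= big_mkord.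
  rewrite mulNr natr_sum_ord -sumrN; apply: ler_sum => i _.
  by have /andP[] := BF w i.+1 g i.+1 hF hB.
rewrite leNgt; apply/negP => lt.
pose e := (c - Lambda 0) / 2; have e0 : 0 < e by rewrite /e; lra.
pose e' := Num.min e (c / 2).
have e'0 : 0 < e' < c.
  rewrite lt_min e0 gt_min divr_gt0 //=; apply/orP; right.
  by have := c0; lra.
have e'e : e' <= e by rewrite ge_min lexx.
pose Up : set R := `]c - e', +oo[%classic; pose Dn : set R := `]-oo, - c + e'[%classic.
have mU : measurable Up by exact: measurable_itv.
have mD : measurable Dn by exact: measurable_itv.
pose E := F 0 @^-1` Up `&` F 1 @^-1` Dn.
have mE : measurable E by apply: measurableI; exact: (measurable_Fpre mF).
have PE : (0 < P E)%E.
  have [p1 _] := tail_gt0 rho_cont rho_gt0 rho_out PF 0 e'0.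
  have [_ p2] := tail_gt0 rho_cont rho_gt0 rho_out PF 1 e'0.
  rewrite /E (ind2 ind) //; exact: mule_gt0.
have [w [[cv hF hB]]] : exists w, [/\ forall a, -1 <= a <= 1 ->
     (fun n : nat => min_action (fun i => B i w) (fun x => F x w) n (round0 (a * n%:R)) / n%:R)
       @ \oo --> - Lambda a, forall x, `|F x w| <= c &
       forall n : nat, B n%:Z w = 1 \/ B n%:Z w = -1] /\
       \sum_(i <- [:: tt]) (fun=> 1 : R) i * \1_((fun=> ~` E) i) w < 1.
  apply: markov_select ae3 _ => //; first by move=> _; exact: measurableC.
  rewrite big_seq1 mul1e probability_setC //.
  have fE : P E \is a fin_num by exact: fin_num_measure.
  move: PE; rewrite -(fineK fE) lte_fin -EFinB lte_fin; lra.
rewrite big_seq1 mul1r indicE; case: (boolP (w \in ~` E)) => /=; first by rewrite ltxx.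
rewrite notin_setE => /contrapT -[/= F0 F1] _.
move: F0 F1; rewrite /Up /Dn /= !in_itv /= andbT => F0 F1.
suff : - Lambda 0 <= - (c - e) by rewrite /e; lra.
(* The last step has to be at the origin and may cost c; the term 4 c / (n + 1) absorbs it. *)
have : (fun n : nat => - (c - e) + 4 * c * harmonic n) @ \oo --> - (c - e) + 4 * c * 0.
  apply: cvgD; first exact: cvg_cst.
  by apply: cvgM; [exact: cvg_cst|exact: cvg_harmonic].
rewrite mulr0 addr0 => cu.
apply: ler_cvg_to (cv 0 z1) cu _.
exists 1%N => // n /= n1; rewrite ler_pdivrMr ?ltr0n // r0.
pose g (i : nat) : int := if (i == 0%N) || (i == n) then 0 else if B i%:Z w == 1 then 1 else 0.
have gl : lazy_walk n 0 g.
  split; first by rewrite /g eqxx. split; first by rewrite /g eqxx orbT.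
  by move=> i _; rewrite /g; case: ifP => _; case: ifP => _; try case: ifP => _; try case: ifP => _; rewrite ?subrr ?subr0 ?sub0r ?normrN.
apply: (@le_trans _ _ (action (B^~ w) (F^~ w) n g)).
  by apply: ge_inf; [exact: has_lbound_action|exists g].
case: n n1 @g gl => // n _ g gl.
rewrite /action big_nat_recr //=.
apply: (@le_trans _ _ (\sum_(1 <= i < n.+1) (- (c - e)) + c)).
  apply: lerD; last by have /andP[] := BF w n.+1 g n.+1 hF hB.
  rewrite !big_nat; apply: ler_sum => i /andP[i1 i2].
  rewrite /g gtn_eqF // ltn_eqF //=.
  have n11 : (-1 == 1 :> R) = false by apply/negbTE; rewrite lt_eqF //; lra.
  case: (hB i) => Bi; rewrite Bi ?eqxx ?n11 ?mul1r ?mulN1r; first by move: F1; lra.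
  by move: F0; lra.
rewrite sumr_const_nat subn1 /= -[_ *+ n]mulr_natr /harmonic /= -[n.+2%:R]natr1 -[n.+1%:R]natr1.
set x : R := n%:R; have x0 : 0 <= x by [].
have -> : (- (c - e) + 4 * c * (x + 1 + 1)^-1) * (x + 1) =
    - (c - e) * x + c + (2 * c * x + e * (x + 2)) / (x + 1 + 1).
  by field; apply/eqP; lra.
rewrite lerDl divr_ge0 //; last lra.
by rewrite addr_ge0 // mulr_ge0 //; lra.
Qed.

End Zero.

(** * Choice of the environment *)

Lemma eventually_all (Pr : nat -> nat -> Prop) (k : nat) :
  (forall q, (q < k)%N -> exists N, forall m, (N <= m)%N -> Pr q m) ->
  exists N, forall m, (N <= m)%N -> forall q, (q < k)%N -> Pr q m.
Proof.
elim: k => [|k IH] H; first by exists 0%N.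
have [|N1 H1] := IH; first by move=> q qk; apply: H; exact: ltnW.
have [N2 H2] := H k (ltnSn k).
exists (maxn N1 N2) => m; rewrite geq_max => /andP[m1 m2] q; rewrite ltnS leq_eqVlt.
by move=> /orP[/eqP ->|qk]; [exact: H2|exact: H1].
Qed.

Lemma natr_size_filter (R : realType) (I : Type) (p : pred I) (s : seq I) :
  (size [seq x <- s | p x])%:R = \sum_(x <- s) (p x)%:R :> R.
Proof.
elim: s => [|x s IH]; first by rewrite big_nil.
by rewrite big_cons -IH /=; case: (p x); rewrite ?add0r //= -natr1 addrC.
Qed.

Lemma size_window n : size (window n) = n.*2.+1.
Proof. by rewrite size_map size_iota. Qed.

Section Env.
Context {R : realType} (c q kappa : R) (rho : R -> R).
Hypothesis c0 : 0 < c.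
Hypothesis q0 : 0 < q.
Hypothesis k0 : 0 < kappa.
Hypothesis rhoN : forall x, rho (- x) = rho x.
Hypothesis rho_cont : {in `]-c, c[, continuous rho}.
Hypothesis rho_gt0 : forall x, - c < x < c -> 0 < rho x.
Hypothesis rho_out : forall x, ~ (- c < x < c) -> rho x = 0.
Hypothesis rho_lim : (fun x => rho x / (c - x) `^ kappa) @ at_left c --> q.
Context {d : measure_display} {T : measurableType d} (P : probability T R).
Variables (F B : int -> T -> R).
Hypothesis mF : forall x, measurable_fun setT (F x).
Hypothesis mB : forall i, measurable_fun setT (B i).
Hypothesis ind : mutually_independent P (FB_family F B).
Hypothesis PB1 : forall i, P (B i @^-1` [set 1]) = (1 / 2)%:E.
Hypothesis PBN : forall i, P (B i @^-1` [set -1]) = (1 / 2)%:E.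
Hypothesis PF : forall x (A : set R), measurable A ->
     P (F x @^-1` A) = (\int[lebesgue_measure]_(y in A) (rho y)%:E)%E.
Variable Lambda : R -> R.
Hypothesis shape : {ae P, forall w, forall a, -1 <= a <= 1 ->
     (fun n : nat => min_action (fun i => B i w) (fun x => F x w) n (round0 (a * n%:R)) / n%:R)
       @ \oo --> - Lambda a}.


Lemma fine_le (E : set T) (x : R) : measurable E -> (P E <= x%:E)%E -> fine (P E) <= x.
Proof.
by move=> mE; have /fineK {1}<- : P E \is a fin_num by exact: fin_num_measure.
Qed.

Lemma markov_real (I : eqType) (r : seq I) (a : I -> R) (E : I -> set T) (O : set T) :
  (forall i, 0 <= a i) -> (forall i, measurable (E i)) -> {ae P, forall w, O w} ->
  \sum_(i <- r) a i * fine (P (E i)) < 1 ->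
  exists w, O w /\ \sum_(i <- r) a i * (w \in E i)%:R < 1.
Proof.
move=> a0 mE aeO lt; have [||||w [Ow H]] := @markov_select R d T P I r a E O => //.
  rewrite (eq_bigr (fun i => (a i * fine (P (E i)))%:E)); last first.
    by move=> i _; rewrite EFinM fineK //; exact: fin_num_measure.
  by rewrite sumEFin lte_fin.
by exists w.
Qed.

(** Along the lengths k m the endpoint Q m has slope exactly Q/k, so no rounding occurs in the limit
    defining [Lambda]. *)
Lemma grid_prob (Q k : nat) (xi e : R) : (0 < Q <= k)%N -> 0 < xi -> 0 < e ->
  exists N, forall m, (N <= m)%N ->
  avg (k * m) (fun b => fine (P (badF F c (c - Lambda (Q%:R / k%:R)) xi (k * m) (Q * m) b))) <= e.
Proof.
move=> /andP[Q0 Qq] xi0 e0.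
have qR : 0 < k%:R :> R by rewrite ltr0n (leq_trans Q0).
have qm m : (Q * m <= k * m)%N by rewrite leq_mul2r Qq orbT.
pose X m w := (c * (k * m)%:R + min_action (B^~ w) (F^~ w) (k * m) (Q * m)%:Z) / (k * m)%:R.
have mX m : measurable_fun setT (X m).
  apply: measurable_funM => //; apply: measurable_funD => //.
  by apply: measurable_min_action.
have aq : -1 <= (Q%:R / k%:R : R) <= 1.
  rewrite ler_pdivrMr // mul1r ler_nat Qq andbT.
  by apply: (@le_trans _ _ 0); [lra|rewrite divr_ge0].
have cX : {ae P, forall w, X^~ w @ \oo --> c - Lambda (Q%:R / k%:R)}.
  apply: filterS shape => w /(_ _ aq) cv.
  apply/cvgrPdist_lt => eps eps0.
  have /cvgrPdist_lt/(_ _ eps0)[N _ H] := cv.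
  exists N.+1 => // m /= Nm; have m0 : (0 < m)%N by exact: leq_trans Nm.
  have m0' : m%:R != 0 :> R by rewrite pnatr_eq0 -lt0n.
  have Nqm : (N <= k * m)%N.
    by apply: (leq_trans (ltnW Nm)); apply: leq_pmull; exact: leq_trans Qq.
  have := H _ Nqm; rewrite /= (_ : Q%:R / k%:R * (k * m)%:R = (Q * m)%:R); last first.
    by rewrite !natrM; field; exact: lt0r_neq0.
  rewrite round0_nat; congr (_ < _); congr `|_|; rewrite /X !natrM; field.
  by rewrite m0' lt0r_neq0.
have [N H] := prob_cvg mX cX xi0 e0.
exists N => m Nm; have HN := H m Nm.
have := avg_badF mF mB ind PB1 PBN c (c - Lambda (Q%:R / k%:R)) xi (qm m).
rewrite (eq_bigr (fun b => (2^-1 ^+ (k * m) *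
   fine (P (badF F c (c - Lambda (Q%:R / k%:R)) xi (k * m) (Q * m) b)))%:E)); last first.
  by move=> b _; rewrite EFinM fineK //; apply: fin_num_measure; exact: measurable_badF.
rewrite sumEFin -mulr_sumr exprVn mulrC -avgE => h.
by rewrite -lee_fin; apply: (le_trans h); exact/ltW/HN.
Qed.

(** Both requirements, control of the loss on the grid and of the number of good bonds at each
    level, are sums of probabilities, so a single first-moment selection yields one environment
    meeting them all. *)
Lemma env_exists (e th xi0 : R) (j0 J A Q N0 : nat) :
  th = (1 / 2) `^ (kappa / 4) -> 0 < th < 1 ->
  (forall h x, 0 < h <= e ->
    (P (edge_pair c F h x) <= (2 * (2 * q * h `^ kappa * h) ^+ 2)%:E)%E) ->
  (1 / 2) ^+ j0 <= e -> 24 * q ^+ 2 * (th ^+ j0 / (1 - th)) <= 1 / 4 ->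
  (0 < A)%N -> (0 < Q)%N -> 0 < xi0 ->
  exists m, (N0 < m)%N /\ exists w, [/\ forall x, `|F x w| <= c,
    forall k, (Q <= k <= A * Q)%N ->
      avg (k * m) (fun b => (xi0 < `|mloss c (F^~ w) (k * m) (Q * m) b / (k * m)%:R -
        (c - Lambda (Q%:R / k%:R))|)%R%:R) <= xi0 &
    forall j, (j0 <= j <= J)%N ->
      (size (good_sites c (F^~ w) ((1 / 2) ^+ j) (A * Q * m)))%:R <= mu th j * (A * Q * m)%:R].
Proof.
move=> thE th01 He j0e Hq A0 Q0 xi00.
have t0 : 0 < th by case/andP: th01.
pose G : R := (A * Q).+1%:R; have G0 : 0 < G by rewrite ltr0n.
have [N HN] : exists N, forall m, (N <= m)%N -> forall k, (k < (A * Q).+1)%N -> (Q <= k)%N ->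
   avg (k * m) (fun b => fine (P (badF F c (c - Lambda (Q%:R / k%:R)) xi0 (k * m) (Q * m) b)))
     <= xi0 / (4 * G).
  apply: eventually_all => k _; have [Qk|] := leqP Q k; last by exists 0%N.
  have Qk' : (0 < Q <= k)%N by rewrite Q0.
  have xG : 0 < xi0 / (4 * G) by rewrite divr_gt0 // mulr_gt0.
  have [N H] := grid_prob Qk' xi00 xG.
  by exists N => m Nm _; exact: H.
exists (maxn N N0).+1; split; first by rewrite ltnS leq_maxr.
set m := (maxn N N0).+1; set n := (A * Q * m)%N.
have Nm : (N <= m)%N by rewrite leqW // leq_maxl.
have n0 : (0 < n)%N by rewrite !muln_gt0 A0 Q0.
have nR : 0 < n%:R :> R by rewrite ltr0n.
have m0 j : 0 < mu th j by exact: mu_gt0.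
pose r1 := [seq (k, b) | k <- index_iota Q (A * Q).+1, b <- bits (k * m)].
pose r2 := [seq (j, x) | j <- index_iota j0 J.+1, x <- window n].
pose r : seq ((nat * seq bool) + (nat * int))%type := map inl r1 ++ map inr r2.
pose a (i : ((nat * seq bool) + (nat * int))%type) : R :=
  match i with inl (k, b) => xi0^-1 / 2 ^+ (k * m) | inr (j, x) => (mu th j * n%:R)^-1 end.
pose E (i : ((nat * seq bool) + (nat * int))%type) : set T := match i with
  | inl (k, b) => if (Q <= k)%N then badF F c (c - Lambda (Q%:R / k%:R)) xi0 (k * m) (Q * m) b else set0
  | inr (j, x) => edge_pair c F ((1 / 2) ^+ j) x end.
have a0 i : 0 <= a i.
  case: i => [[k b]|[j x]] /=; first by rewrite divr_ge0 ?invr_ge0 ?exprn_ge0 // ltW.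
  by rewrite invr_ge0 mulr_ge0 // ltW.
have mE i : measurable (E i).
  case: i => [[k b]|[j x]] /=; last exact: measurable_edge_pair.
  case: ifP => // Qk; apply: measurable_badF => //; by rewrite leq_mul2r Qk orbT.
have split_sum (g : ((nat * seq bool) + (nat * int))%type -> R) : \sum_(i <- r) a i * g i =
    \sum_(Q <= k < (A * Q).+1) xi0^-1 * avg (k * m) (fun b => g (inl (k, b))) +
    \sum_(j0 <= j < J.+1) (mu th j * n%:R)^-1 * \sum_(x <- window n) g (inr (j, x)).
  rewrite big_cat !big_map !big_allpairs_dep; congr (_ + _).
    apply: eq_bigr => k _; rewrite avgE mulrA mulrAC mulr_sumr.
    by apply: eq_bigr.
  by apply: eq_bigr => j _; rewrite mulr_sumr.
have [w [Fw]] : exists w, (forall x, `|F x w| <= c) /\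
    \sum_(i <- r) a i * (w \in E i)%:R < 1.
  apply: (@markov_real _ r a E (fun w => forall x, `|F x w| <= c)) => //.
    exact: (ae_F_le rho_out mF PF).
  rewrite split_sum.
  (* Each grid length contributes at most 1 / (4 G). Each level contributes at most 24 q^2 th^j: 8
     q^2 from the pair probability and 3 n for the size of the window. *)
  apply: (@le_lt_trans _ _ (1 / 4 + 1 / 4)); last lra.
  apply: lerD.
    apply: (@le_trans _ _ (\sum_(Q <= k < (A * Q).+1) (4 * G)^-1)).
      rewrite !big_nat; apply: ler_sum => k /andP[k1 k2].
      rewrite ler_pdivrMl //; apply: le_trans (HN m Nm k k2 k1) => /=.
      by rewrite k1.
    rewrite sumr_const_nat -[_ *+ (_ - _)]mulr_natr ler_pdivrMl ?mulr_gt0 //.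
    have : ((A * Q).+1 - Q)%:R <= G by rewrite ler_nat leq_subr.
    lra.
  apply: (@le_trans _ _ (\sum_(j0 <= j < J.+1) 24 * q ^+ 2 * th ^+ j)); last first.
    rewrite -mulr_sumr; apply: le_trans Hq; rewrite ler_wpM2l //.
      by rewrite mulr_ge0 // sqr_ge0.
    exact: geom_tail.
  rewrite !big_nat; apply: ler_sum => j /andP[j1 j2].
  have hj0 : 0 < (1 / 2) ^+ j :> R by rewrite exprn_gt0.
  have hje : 0 < ((1 / 2) ^+ j : R) <= e.
    rewrite hj0 /=; apply: le_trans j0e; apply: ler_wiXn2l => //; lra.
  rewrite ler_pdivrMl ?(mulr_gt0 (m0 j) nR) //.
  (* Since th = 2^(- kappa / 4), the factor (2^-j)^kappa is [th ^+ (4 * j)]: after its square, half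
     of the exponent goes into [mu] and half is left to sum over levels. *)
  have pE : 2 * (2 * q * ((1 / 2) ^+ j) `^ kappa * (1 / 2) ^+ j) ^+ 2 =
      8 * q ^+ 2 * (mu th j * th ^+ (4 * j)).
    have -> : ((1 / 2 : R) ^+ j) `^ kappa = th ^+ (4 * j).
      rewrite thE exprM -[_ ^+ 4]powR_mulrn ?powR_ge0 // -powRrM divfK ?pnatr_eq0 //.
      have z : 0 <= 1 / 2 :> R by [].
      by rewrite -(powR_mulrn j z) -(powR_mulrn j (powR_ge0 _ _)) -!powRrM [j%:R * _]mulrC.
    rewrite /mu (_ : (1 / 4 : R) ^+ j = (1 / 2) ^+ j * (1 / 2) ^+ j); last first.
      by rewrite -exprMn; congr (_ ^+ _); field.
    ring.
  apply: (@le_trans _ _ (\sum_(x <- window n) 8 * q ^+ 2 * (mu th j * th ^+ (4 * j)))).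
    apply: ler_sum => x _ /=; rewrite -pE; apply: fine_le; last exact: He.
    exact: measurable_edge_pair.
  rewrite big_const_seq count_predT iter_addr addr0 size_window -[_ *+ n.*2.+1]mulr_natr.
  have n3 : n.*2.+1%:R <= 3 * n%:R :> R by rewrite -natrM ler_nat -mul2n mulSn -add1n leq_add2r.
  have t4 : th ^+ (4 * j) <= th ^+ j.
    by case/andP: th01 => _ t1; apply: ler_wiXn2l; [exact: ltW|exact: ltW|rewrite leq_pmull].
  have z0 : 0 <= 8 * q ^+ 2 * mu th j by rewrite mulr_ge0 ?(ltW (m0 j)) // mulr_ge0 // sqr_ge0.
  apply: (@le_trans _ _ (8 * q ^+ 2 * mu th j * th ^+ (4 * j) * (3 * n%:R))).
    by rewrite mulrA; apply: ler_wpM2l => //; rewrite mulr_ge0 // exprn_ge0 // (ltW t0).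
  apply: (@le_trans _ _ (8 * q ^+ 2 * mu th j * th ^+ j * (3 * n%:R))).
    apply: ler_wpM2r; first by rewrite mulr_ge0 // ltW.
    exact: ler_wpM2l.
  by rewrite le_eqVlt; apply/orP; left; apply/eqP; ring.
rewrite (split_sum (fun i => (w \in E i)%:R)); set S1 := (X in X + _ < 1); set S2 := (X in _ + X < 1) => lt.
have S1ge k : 0 <= xi0^-1 * avg (k * m) (fun b => (w \in E (inl (k, b)))%:R).
  by rewrite mulr_ge0 ?invr_ge0 ?(ltW xi00) // avg_ge0.
have S2ge j : 0 <= (mu th j * n%:R)^-1 * \sum_(x <- window n) (w \in E (inr (j, x)))%:R.
  apply: mulr_ge0; last by apply: sumr_ge0.
  by rewrite invr_ge0 ltW // (mulr_gt0 (m0 j) nR).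
have S10 : 0 <= S1 by apply: sumr_ge0.
have S20 : 0 <= S2 by apply: sumr_ge0.
exists w; split => //.
- move=> k /andP[k1 k2].
  have : xi0^-1 * avg (k * m) (fun b => (w \in E (inl (k, b)))%:R) <= 1.
    apply: (@le_trans _ _ S1); last lra.
    rewrite /S1 (bigD1_seq k) /= ?iota_uniq ?mem_index_iota ?k1 ?ltnS //.
    by rewrite lerDl; apply: sumr_ge0.
  rewrite ler_pdivrMl // mulr1; apply: le_trans; apply: le_avg => b _ /=.
  by rewrite k1 ler_nat; case: ltP => // lt1; rewrite mem_set.
move=> j jj.
have : (mu th j * n%:R)^-1 * \sum_(x <- window n) (w \in E (inr (j, x)))%:R <= 1.
  apply: (@le_trans _ _ S2); last lra.
  rewrite /S2 (bigD1_seq j) /= ?iota_uniq ?mem_index_iota ?ltnS //.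
  by rewrite lerDl; apply: sumr_ge0.
rewrite ler_pdivrMl ?(mulr_gt0 (m0 j) nR) // mulr1; apply: le_trans.
rewrite natr_size_filter; apply: ler_sum => x _; rewrite ler_nat.
case: ltP => // lt1 /=; rewrite mem_set //.
exact: gap_edge_pair.
Qed.

End Env.

(** * Convexity and the choice of constants *)

(** A convex function lies below its chord on [0, a]; being strictly below it at one point [x] would
    force it strictly below at [r * a]. That point is a convex combination of 0 and [x], or of [x]
    and [a], depending on the side of [x]. *)
Lemma chord_linear (R : realType) (h : R -> R) (a r : R) :
  (forall x y t, 0 <= x <= 1 -> 0 <= y <= 1 -> 0 <= t <= 1 ->
     h (t * x + (1 - t) * y) <= t * h x + (1 - t) * h y) ->
  h 0 = 0 -> 0 < a -> a <= 1 -> 0 < r < 1 -> r * h a <= h (r * a) ->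
  forall x, 0 <= x <= a -> h x = h a / a * x.
Proof.
move=> conv h0 a_gt0 a_le1 /andP[r0 r1] above x /andP[x0 xa].
have star y t : 0 <= y <= 1 -> 0 <= t <= 1 -> h (t * y) <= t * h y.
  move=> yI tI; have zI : 0 <= (0 : R) <= 1 by rewrite lexx ler01.
  by have := conv y 0 t yI zI tI; rewrite h0 !mulr0 !addr0.
have aI : 0 <= a <= 1 by rewrite a_le1 ltW.
set s := h a / a; have sE : h a = s * a by rewrite /s divfK // lt0r_neq0.
apply/eqP; rewrite eq_le; apply/andP; split.
  have tI : 0 <= x / a <= 1 by rewrite divr_ge0 ?(ltW a_gt0) //= ler_pdivrMr // mul1r.
  have := star a (x / a) aI tI; rewrite divfK ?lt0r_neq0 // => H.
  by apply: (le_trans H); rewrite /s le_eqVlt; apply/orP; left; apply/eqP; ring.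
have p0 : 0 < r * a by rewrite mulr_gt0.
have [px|xp] := leP (r * a) x.
  have x_gt0 : 0 < x by exact: lt_le_trans px.
  have xI : 0 <= x <= 1 by rewrite x0 (le_trans xa).
  have tI : 0 <= r * a / x <= 1 by rewrite divr_ge0 ?(ltW p0) //= ler_pdivrMr // mul1r.
  have := star x (r * a / x) xI tI; rewrite divfK ?lt0r_neq0 // => H.
  have H2 : r * h a <= r * a / x * h x by exact: le_trans H.
  have q0 : 0 < r * a / x by rewrite divr_gt0.
  rewrite -(ler_pM2l q0); apply: le_trans H2.
  rewrite sE le_eqVlt; apply/orP; left; apply/eqP; field.
  by rewrite lt0r_neq0.
have ra : r * a < a by rewrite -[ltRHS]mul1r ltr_pM2r.
have d0 : 0 < a - x by rewrite subr_gt0 (lt_trans xp).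
pose t := (a - r * a) / (a - x).
have tE : t * (a - x) = a - r * a by rewrite /t divfK // lt0r_neq0.
have t0 : 0 < t by rewrite /t divr_gt0 // subr_gt0.
have t1 : t <= 1 by rewrite /t ler_pdivrMr // mul1r lerD2l lerN2 ltW.
have xI : 0 <= x <= 1 by rewrite x0 (le_trans xa).
have tI : 0 <= t <= 1 by rewrite t1 ltW.
have := conv x a t xI aI tI.
have pE : t * x + (1 - t) * a = r * a.
  have -> : t * x + (1 - t) * a = a - t * (a - x) by ring.
  by rewrite tE; ring.
rewrite pE => H; have := le_trans above H; rewrite sE => H2.
rewrite -(ler_pM2l t0) -(lerD2r ((1 - t) * (s * a))); apply: le_trans H2.
rewrite le_eqVlt; apply/orP; left; apply/eqP.
have -> : r * (s * a) = s * (r * a) by ring.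
by rewrite -pE; ring.
Qed.

Unset Implicit Arguments. Set Strict Implicit. Set Printing Implicit Defensive.

Theorem theorem2p3 (R : realType) (c q kappa : R) (rho : R -> R)
  (d : measure_display) (T : measurableType d) (P : probability T R)
  (F B : int -> T -> R) (Lambda : R -> R) :
  0 < c -> 0 < q -> -1 < kappa ->
  (* density rho *)
  (forall x, rho (- x) = rho x) ->
  {in `]-c, c[, continuous rho} ->
  (forall x, - c < x < c -> 0 < rho x) ->
  (forall x, ~ (- c < x < c) -> rho x = 0) ->
  (fun x => rho x / (c - x) `^ kappa) @ at_left c --> q ->
  (* the random environment *)
  (forall x, measurable_fun setT (F x)) ->
  (forall i, measurable_fun setT (B i)) ->
  mutually_independent P (FB_family F B) ->
  (forall i, P (B i @^-1` [set 1]) = (1 / 2)%:E) ->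
  (forall i, P (B i @^-1` [set -1]) = (1 / 2)%:E) ->
  (forall x (A : set R), measurable A ->
     P (F x @^-1` A) = (\int[lebesgue_measure]_(y in A) (rho y)%:E)%E) ->
  (* Lambda is the shape function *)
  {within `[-1, 1], continuous Lambda} ->
  (forall a, -1 <= a <= 1 -> Lambda (- a) = Lambda a) ->
  (forall a b t, -1 <= a <= 1 -> -1 <= b <= 1 -> 0 <= t <= 1 ->
     t * Lambda a + (1 - t) * Lambda b <= Lambda (t * a + (1 - t) * b)) ->
  (forall a, -1 <= a <= 1 -> 0 <= Lambda a) ->
  {ae P, forall w, forall a, -1 <= a <= 1 ->
     (fun n : nat => min_action (fun i => B i w) (fun x => F x w) n (round0 (a * n%:R)) / n%:R)
       @ \oo --> - Lambda a} ->
  (* additional assumption *)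
  0 < kappa ->
  exists a0 : R, 0 < a0 < 1 /\
    forall a, - a0 <= a <= a0 ->
      Lambda a = c - ((c - Lambda a0) / a0) * `|a|.
Proof.
move=> c0 q0 _ rhoN rho_cont rho_gt0 rho_out rho_lim mF mB ind PB1 PBN PF _ Leven Lconc Lge0 shape k0.
have L0 := Lambda0 c0 rho_cont rho_gt0 rho_out mF mB ind PB1 PBN PF shape.
have [e e0 He] := edge_pair_prob c0 q0 k0 rhoN rho_cont rho_gt0 rho_out rho_lim mF ind PF.
pose th : R := (1 / 2) `^ (kappa / 4).
have t0 : 0 < th by apply: powR_gt0; lra.
have t1 : th < 1.
  rewrite /th /powR gt_eqF; last lra.
  rewrite expR_lt1 pmulr_rlt0; last by rewrite divr_gt0.
  by apply: ln_lt0; apply/andP; split; lra.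
have th01 : 0 < th < 1 by rewrite t0 t1.
pose h (x : R) := c - Lambda x.
have hle x : 0 <= x <= 1 -> 0 <= h x <= c.
  move=> /andP[x0 x1]; have x1' : -1 <= x <= 1 by lra.
  have xN : -1 <= - x <= 1 by lra.
  have := Lge0 x x1'; have h2 : 0 <= (1 / 2 : R) <= 1 by lra.
  have := Lconc x (- x) (1 / 2) x1' xN h2; rewrite Leven //.
  have -> : 1 / 2 * x + (1 - 1 / 2) * - x = 0 by field.
  rewrite L0 /h; lra.
have hstar t x : 0 <= t <= 1 -> 0 <= x <= 1 -> h (t * x) <= t * h x.
  move=> t01 /andP[x0 x1]; have x1' : -1 <= x <= 1 by lra.
  have z1 : -1 <= (0 : R) <= 1 by lra.
  by have := Lconc x 0 t x1' z1 t01; rewrite L0 mulr0 addr0 /h; lra.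
have hmono x y : 0 < x -> x <= y -> y <= 1 -> h x / x <= h y / y.
  move=> x0 xy y1; have y0 : 0 < y by exact: lt_le_trans xy.
  have xy1 : 0 <= x / y <= 1.
    by rewrite divr_ge0 ?(ltW x0) ?(ltW y0) //= ler_pdivrMr // mul1r.
  have y01 : 0 <= y <= 1 by lra.
  have := hstar (x / y) y xy1 y01; rewrite divfK ?lt0r_neq0 // => H.
  rewrite ler_pdivrMr //; apply: (le_trans H).
  by rewrite le_eqVlt; apply/orP; left; apply/eqP; ring.
pose lam := ln (4 / th ^+ 4).
have lam0 : 0 <= lam.
  apply: ln_ge0; rewrite ler_pdivlMr ?exprn_gt0 // mul1r.
  by apply: (@le_trans _ _ 1); [apply: exprn_ile1; exact: ltW|lra].
have lt0 : 0 < - ln th by rewrite oppr_gt0; exact: ln_lt0.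
(* Of the two factors [th ^+ j] in the entropy condition, one absorbs the linear term in [j] and the
   other is left to make the product small. *)
pose K3 := 16 * c ^+ 2 * (2 * lam / (- ln th) + 1).
have K30 : 0 <= K3.
  apply: mulr_ge0; first by rewrite mulr_ge0 // sqr_ge0.
  by rewrite addr_ge0 // divr_ge0 ?(ltW lt0) // mulr_ge0.
have Hj3 j : 16 * c ^+ 2 * (2 * lam * j%:R + 1) * th ^+ (2 * j) <= K3 * th ^+ j.
  rewrite mul2n -addnn exprD mulrA ler_pM2r ?exprn_gt0 // /K3 -mulrA.
  apply: ler_wpM2l; first by rewrite mulr_ge0 // sqr_ge0.
  rewrite mulrDl mul1r; apply: lerD; last by apply: exprn_ile1; exact: ltW.
  rewrite -!mulrA [leLHS]mulrA [leRHS]mulrA; apply: ler_wpM2l; first by rewrite mulr_ge0.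
  rewrite -[leRHS]mul1r ler_pdivlMr // mulrC mulrA; exact: linear_pow.
have s0 : 0 < 1 - th by rewrite subr_gt0.
(* [D] dominates all constants to be beaten by th^j for j >= j0: the entropy, the tail sum (8 * 32 =
   256), the bound 1/96 on [mu], and the count of good bonds (24 * 4 = 96). *)
pose D := K3 + 256 / (1 - th) + 96 + 96 * q ^+ 2 / (1 - th).
have u1 : 0 <= 256 / (1 - th) by rewrite divr_ge0 // ltW.
have u2 : 0 <= 96 * q ^+ 2 / (1 - th).
  by rewrite divr_ge0 ?(ltW s0) // mulr_ge0 // sqr_ge0.
have D0 : 0 < D by rewrite /D; lra.
have KD1 : K3 <= D by rewrite /D; lra.
have KD2 : 256 / (1 - th) <= D by rewrite /D; lra.
have KD3 : 96 <= D by rewrite /D; lra.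
have KD4 : 96 * q ^+ 2 / (1 - th) <= D by rewrite /D; lra.
clearbody D.
have m0 : 0 < Num.min e (2 * c) by rewrite lt_min e0 mulr_gt0.
have D0' : 0 < D^-1 by rewrite invr_gt0.
have h12 : 0 < (1 / 2 : R) < 1 by lra.
have [N1 HN1] := small_pow th01 D0'.
have [N2 HN2] := small_pow h12 m0.
pose j0 := maxn N1 N2.
have Dj K j : K <= D -> (j0 <= j)%N -> K * th ^+ j <= 1.
  move=> KD j0j; have pj : 0 < th ^+ j by rewrite exprn_gt0.
  have H := HN1 j (leq_trans (leq_maxl _ _) j0j).
  apply: (@le_trans _ _ (D * D^-1)); last by rewrite mulfV // lt0r_neq0.
  by apply: (@le_trans _ _ (D * th ^+ j)); [rewrite ler_pM2r|rewrite ler_pM2l].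
have := HN2 j0 (leq_maxr _ _); rewrite le_min => /andP[j0e j0c].
have pj0 : 0 < (1 / 2) ^+ j0 :> R by rewrite exprn_gt0.
(* Since h(a1) <= a1 c, this size makes h(a1) at most 2^-j0 / 64, half of what the top level
   allows. *)
pose A' := (Num.truncn (64 * c / (1 / 2) ^+ j0)).+1.
pose A := A'.*2.
have AR : 64 * c < (1 / 2) ^+ j0 * A%:R.
  have := truncnS_gt (64 * c / (1 / 2) ^+ j0); rewrite -/A' ltr_pdivrMr // => H.
  apply: (lt_le_trans H); rewrite [leRHS]mulrC ler_pM2r // ler_nat /A -addnn; exact: leq_addr.
have A2 : 2 <= A%:R :> R by rewrite (ler_nat _ 2) /A doubleS.
have A0 : 0 < A%:R :> R by apply: lt_le_trans A2.
pose a1 := 1 / A%:R : R; pose a0 := 32 / 31 / A%:R : R.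
have a1E : a1 = 31 / 32 * a0 by rewrite /a1 /a0; field; exact: lt0r_neq0.
have a00 : 0 < a0 by rewrite /a0 !divr_gt0.
have a01 : a0 < 1 by rewrite /a0 ltr_pdivrMr //; move: A2; clear; lra.
have ha1 : h a1 <= (1 / 2) ^+ j0 / 64.
  have x1 : 0 <= a1 <= 1 by move: a1E a00 a01; clear; lra.
  have i1 : 0 <= (1 : R) <= 1 by rewrite ler01 lexx.
  have := hstar a1 1 x1 i1; rewrite mulr1 => H; apply: (le_trans H).
  have /andP[_ h1c] := hle 1 i1.
  apply: (@le_trans _ _ (a1 * c)); first by apply: ler_wpM2l => //; case/andP: x1.
  by rewrite /a1 mul1r [leLHS]mulrC ler_pdivrMr //; move: AR; clear; lra.
(* [j0] and [A], hence both slopes, are fixed by now; [xi0], [Q], [m] and the environment may depend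
   on [J]. *)
have key J : (j0 <= J)%N -> 31 / 32 * h a0 <= h a1 + 2 * eta th J.
  move=> jJ; have eJ := eta_gt0 J t0.
  (* A bound for [zeta], to which [xi0] and [Q] contribute at most z/2 each: 3 z stays below
     [eta th J], and 2 z below the other half of the top-level allowance. *)
  pose z := Num.min (eta th J / 4) ((1 / 2) ^+ j0 / 128).
  have z0 : 0 < z by rewrite lt_min !divr_gt0.
  have [z1 z2] : z <= eta th J / 4 /\ z <= (1 / 2) ^+ j0 / 128.
    by split; rewrite ge_min lexx ?orbT.
  have c1 : 0 < 2 * (1 + c) by rewrite mulr_gt0 // addr_gt0.
  pose xi0 := Num.min (1 / 4) (z / (2 * (1 + c))).
  have xi00 : 0 < xi0 by rewrite lt_min !divr_gt0.
  have [xi4 xiz] : xi0 <= 1 / 4 /\ xi0 * (1 + c) <= z / 2.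
    split; first by rewrite ge_min lexx.
    have : xi0 <= z / (2 * (1 + c)) by rewrite ge_min lexx orbT.
    by rewrite ler_pdivlMr //; clear; lra.
  pose Q := ((Num.truncn (4 * c / z)).+1 + 32)%N.
  have Q0 : (0 < Q)%N by rewrite /Q addn_gt0.
  have QR : 4 * c <= z * Q%:R.
    have := truncnS_gt (4 * c / z); rewrite ltr_pdivrMr // => H.
    by apply: ltW; apply: (lt_le_trans H); rewrite [leRHS]mulrC ler_pM2r // ler_nat leq_addr.
  have A0n : (0 < A)%N by [].
  have AQR : Q%:R <= (A * Q)%:R :> R by rewrite ler_nat leq_pmull.
  have QR0 : 0 < Q%:R :> R by rewrite ltr0n.
  have cz : 2 * c / (A * Q)%:R <= z / 2.
    rewrite ler_pdivrMr; last exact: lt_le_trans AQR.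
    apply: (@le_trans _ _ (z / 2 * Q%:R)); first by move: QR; clear; lra.
    by rewrite ler_pM2l // divr_gt0.
  pose W := 4 * (J.+1%:R * (16 * c ^+ 2)) / eta th J ^+ 2.
  have e2 : 0 < eta th J ^+ 2 by rewrite exprn_gt0.
  have Hq : 24 * q ^+ 2 * (th ^+ j0 / (1 - th)) <= 1 / 4.
    have := Dj _ j0 KD4 (leqnn j0).
    have -> : 96 * q ^+ 2 / (1 - th) * th ^+ j0 = 4 * (24 * q ^+ 2 * (th ^+ j0 / (1 - th))).
      by field; exact: lt0r_neq0.
    by clear; lra.
  have [m [mN [w [Fw Hgrid Hcount]]]] := env_exists rho_out mF mB ind PB1 PBN PF shape
    J (maxn 512 (Num.truncn W).+1) (erefl th) th01 He j0e Hq A0n Q0 xi00.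
  have m1 : (0 < m)%N by exact: leq_ltn_trans mN.
  have mn : (m <= A * Q * m)%N by rewrite leq_pmull // muln_gt0 A0n.
  have /andP[n512 nW] : (512 < m)%N && ((Num.truncn W).+1 < m)%N.
    by move: mN; rewrite gtn_max.
  have xi014 : 0 < xi0 <= 1 / 4 by rewrite xi00.
  have C := @slope_comparison_env R c th j0 J A' Q m (F^~ w) h xi0.
  have {C} : 31 / 32 * h a0 <= h a1 + eta th J +
      3 * (xi0 * (1 + c) + 2 * c / (A * Q)%:R).
    apply: C => //.
    + by apply: (@leq_trans Q); [exact: leq_addl|rewrite -/A leq_pmull].
    + move=> j jj; apply: (le_trans (Hj3 j)); exact: Dj.
    + rewrite -mulr_sumr; have := geom_tail j0 J th01.
      have := Dj _ j0 KD2 (leqnn j0).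
      by rewrite mulrAC -mulrA; clear; lra.
    + apply: (le_trans (mu_le J th01)); have := Dj 96 J KD3 jJ.
      by clear; lra.
    + rewrite -/A; move: xiz cz z1 eJ; clear; lra.
    + rewrite -/A -/a1; move: xiz cz z2 ha1; clear; lra.
    + have := truncnS_gt W; rewrite /W ltr_pdivrMr // -/W => HW.
      apply/ltW/(lt_le_trans HW); rewrite [leRHS]mulrC ler_pM2r // ler_nat.
      exact: leq_trans (ltnW nW) mn.
    + exact: leq_trans (ltnW n512) mn.
  by move: xiz cz z1 eJ; clear; lra.
(* The inequality of [key] at fixed slopes, as [J] tends to infinity; a strict violation would
   contradict it once [eta th J] is small. *)
have slope : 31 / 32 * h a0 <= h a1.
  rewrite leNgt; apply/negP => lt.
  have dd : 0 < (31 / 32 * h a0 - h a1) / 4 by rewrite divr_gt0 // subr_gt0.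
  have [N HN] := small_pow th01 dd.
  have J1 : (j0 <= maxn j0 N)%N by exact: leq_maxl.
  have := key _ J1; have := HN (maxn j0 N) (leq_maxr _ _).
  have : eta th (maxn j0 N) <= th ^+ maxn j0 N.
    rewrite /eta -[leRHS]mul1r ler_pM2r ?exprn_gt0 //; apply: exprn_ile1; lra.
  by move: lt; clear; lra.
exists a0; split; first by rewrite a00 a01.
have main a : 0 <= a <= a0 -> h a = h a0 / a0 * a.
  have r01 : 0 < (31 / 32 : R) < 1 by apply/andP; split; lra.
  apply: (chord_linear (r := 31 / 32)) => //; last first.
    by rewrite -a1E.
    exact: ltW.
    by rewrite /h L0 subrr.
  move=> x y t /andP[x0 x1] /andP[y0 y1] tI.
  have xI : -1 <= x <= 1 by rewrite x1 (le_trans _ x0) // lerN10.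
  have yI : -1 <= y <= 1 by rewrite y1 (le_trans _ y0) // lerN10.
  rewrite -subr_ge0 (_ : _ - _ = Lambda (t * x + (1 - t) * y) -
    (t * Lambda x + (1 - t) * Lambda y)); last by rewrite /h; ring.
  by rewrite subr_ge0; exact: Lconc.
have E0 : (c - Lambda a0) / a0 = h a0 / a0 by [].
move=> a /andP[al au]; rewrite E0.
have [ap|an] := leP 0 a.
  have aa : 0 <= a <= a0 by rewrite ap.
  by rewrite ger0_norm // -main // /h; ring.
have aa : 0 <= - a <= a0 by rewrite oppr_ge0 ltW //= lerNl.
have ai : -1 <= a <= 1.
  rewrite (le_trans (ltW an)) // andbT (le_trans _ al) // lerN2; exact: ltW.
by rewrite ltr0_norm // -main // /h Leven //; ring.
Qed.
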